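(* Let $\Bbbk$ be a field, let $G$ be a finite simple graph with vertex set $V=\{x_1,\dots,x_n\}$, $n\ge 1$, having no isolated vertices, and let $\mathcal C\subseteq V$ be a minimal vertex cover of $G$. Let $R=\Bbbk[x_1,\dots,x_n]$, $S=R[z]$, and let $G(\mathcal C)$ be the $\mathcal C$-suspension of $G$ with new vertex $z$. Then: (a) $\operatorname{reg} S/I(G(\mathcal C)) = \operatorname{reg} R/I(G)$; (b) $\operatorname{pdim} S/I(G(\mathcal C)) = \operatorname{pdim} R/I(G)+1$.
   Context: For a finite simple graph $H$ whose vertices are identified with the variables of a polynomial ring over $\Bbbk$, the edge ideal $I(H)$ is the ideal of that polynomial ring generated by the products $uv$ over all edges $\{u,v\}$ of $H$. A vertex cover of $G$ is a set of vertices meeting every edge; it is minimal if no proper subset is a vertex cover. For $\mathcal C\subseteq V(G)$, the $\mathcal C$-suspension $G(\mathcal C)$ is the graph obtained from $G$ by adjoining a new vertex $z$ joined to every vertex of $\mathcal C$ and to no other vertices; thus $I(G(\mathcal C))=I(G)+(zx_i: x_i\in\mathcal C)\subseteq S=R[z]$. For a finitely generated graded module $M$ over a standard graded polynomial ring with graded Betti numbers $\beta_{i,j}(M)$, $\operatorname{pdim} M=\max\{i:\beta_{i,j}(M)\ne0\text{ for some }j\}$ and $\operatorname{reg} M=\max\{j-i:\beta_{i,j}(M)\neq 0\}$. *)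

(* Defs.v *)
From mathcomp Require Import all_boot all_order all_algebra.
From mathcomp Require Import mpoly.
From Stdlib Require Import ClassicalEpsilon.

Set Implicit Arguments.
Unset Strict Implicit.
Unset Printing Implicit Defensive.

Import GRing.Theory.
Local Open Scope ring_scope.

(** * Graphs on the vertex set ['I_n], given by their adjacency relation *)

Definition vertex_cover n (e : rel 'I_n) : pred {set 'I_n} :=
  fun C => [forall u, forall v, e u v ==> (u \in C) || (v \in C)].

Definition no_isolated n (e : rel 'I_n) : Prop :=
  forall u, exists v, e u v.

(** The new vertex [z] is [ord_max]; the old vertex [i] becomes
    [lift ord_max i], which has the same value as [i]. *)
Definition suspension n (e : rel 'I_n) (C : {set 'I_n}) : rel 'I_n.+1 :=
  fun u v => match unlift ord_max u, unlift ord_max v with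
  | Some i, Some j => e i j
  | Some i, None => i \in C
  | None, Some j => j \in C
  | None, None => false
  end.

(** Ideals are represented by their membership predicate. *)
Definition edge_ideal (k : fieldType) n (e : rel 'I_n) : {mpoly k[n]} -> Prop :=
  fun p => exists c : 'I_n -> 'I_n -> {mpoly k[n]},
    p = \sum_u \sum_(v | e u v) c u v * ('X_u * 'X_v).
Arguments edge_ideal k {n} e _.

(** * Minimal graded free resolutions of cyclic modules [R/I] *)

(** A sequence of free modules of finite rank over [R = k[x_0, ..., x_(n-1)]],
      ... --> F_2 --> F_1 --> F_0 --> R,
    where [F_i] is the direct sum of the [R(- fdeg i a)] for [a < frank i].
    Elements of [F_i] are row vectors, and maps act by right multiplication.
    [faug] is a lift to [R] of the augmentation [F_0 --> R/I].
    Natural numbers suffice as generator degrees, because [R/I] is generated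
    in degree 0. *)
Record free_seq (k : fieldType) (n : nat) := FreeSeq {
  frank : nat -> nat;
  fdeg : forall i, 'I_(frank i) -> nat;
  fdiff : forall i, 'M[{mpoly k[n]}]_(frank i.+1, frank i);
  faug : 'cV[{mpoly k[n]}]_(frank 0)
}.

(** [p] is zero or homogeneous of degree [d - d'] (so zero if [d < d']): the
    condition for an entry [R(-d) --> R(-d')] of a degree-preserving map. *)
Definition homog_entry (k : fieldType) n (d d' : nat) (p : {mpoly k[n]}) : Prop :=
  forall m, m \in msupp p -> (mdeg m + d')%N = d.

Record minimal_graded_free_resolution (k : fieldType) n
    (I : {mpoly k[n]} -> Prop) (F : free_seq k n) : Prop := MinRes {
  mr_diff_graded : forall i a b,
    homog_entry (fdeg (i := i.+1) a) (fdeg (i := i) b) (fdiff F i a b);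
  mr_aug_graded : forall a, homog_entry (fdeg (i := 0) a) 0 (faug F a 0);
  mr_aug_surj : forall p, exists v : 'rV_(frank F 0), I (p - (v *m faug F) 0 0);
  mr_exact0 : forall v : 'rV_(frank F 0),
    I ((v *m faug F) 0 0) <-> exists w, v = w *m fdiff F 0;
  mr_exactS : forall i (v : 'rV_(frank F i.+1)),
    v *m fdiff F i = 0 <-> exists w, v = w *m fdiff F i.+1;
  (* the image of [F_(i+1)] lies in [m F_i], with [m] the irrelevant ideal *)
  mr_minimal : forall i a b, (fdiff F i a b)@_0%MM = 0
}.

Definition zero_free_seq (k : fieldType) n : free_seq k n :=
  @FreeSeq k n (fun=> 0) (fun _ _ => 0) (fun=> 0) 0.

(** A minimal graded free resolution of [R/I]. One exists whenever [I] is a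
    homogeneous ideal, and it is unique up to isomorphism; [epsilon] returns
    an arbitrary sequence otherwise. *)
Definition min_resolution (k : fieldType) n (I : {mpoly k[n]} -> Prop) :
    free_seq k n :=
  epsilon (inhabits (zero_free_seq k n)) (minimal_graded_free_resolution I).

(** The graded Betti number [beta_(i,j)] of the [R]-module [R/I]. *)
Definition betti (k : fieldType) n (I : {mpoly k[n]} -> Prop) (i j : nat) : nat :=
  #|[set a | @fdeg _ _ (min_resolution I) i a == j]|.

(** The maxima below exist when [I] is a proper homogeneous ideal; otherwise
    the values of [pdim_quotient] and [reg_quotient] carry no meaning. *)
Definition is_pdim_quotient (k : fieldType) n (I : {mpoly k[n]} -> Prop)
    (p : nat) : Prop :=
  (exists j, betti I p j <> 0%N) /\
  (forall i j, betti I i j <> 0%N -> (i <= p)%N).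

Definition is_reg_quotient (k : fieldType) n (I : {mpoly k[n]} -> Prop)
    (r : int) : Prop :=
  (exists i j, betti I i j <> 0%N /\ r = j%:Z - i%:Z) /\
  (forall i j, betti I i j <> 0%N -> j%:Z - i%:Z <= r).

Definition pdim_quotient (k : fieldType) n (I : {mpoly k[n]} -> Prop) : nat :=
  epsilon (inhabits 0%N) (is_pdim_quotient I).

Definition reg_quotient (k : fieldType) n (I : {mpoly k[n]} -> Prop) : int :=
  epsilon (inhabits (0 : int)) (is_reg_quotient I).

(* Main.v *)
From HB Require Import structures.
Require Import Defs.
From mathcomp Require Import all_boot all_order all_algebra.
From mathcomp Require Import mpoly.
From Stdlib Require Import ClassicalEpsilon FunctionalExtensionality.
From Stdlib Require Import PropExtensionality.

Set Implicit Arguments.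
Unset Strict Implicit.
Unset Printing Implicit Defensive.

Import GRing.Theory.
Local Open Scope ring_scope.

(** Let [I] be the edge ideal of [G] and [P = (x_c : c in C)], so that the edge
    ideal of the suspension is [J = I + zP]. As [C] is a cover, [I <= P] and
    [I] meets [zP] in [zI]; hence [0 -> zI -> I + zP (direct) -> J -> 0] is
    exact, and its mapping cone resolves [J]. The lift of [I -> P] to
    resolutions has all entries in the maximal ideal, because the [i]-th module
    of the Koszul resolution of [P] is generated in degree [i + 1], whereas that
    of a minimal resolution of [I] is generated in degrees at least [i + 2], counting from [0]. So
    the cone is minimal, and every degree shift occurring in it is one of
    [I] (possibly twisted by one and moved one step up) or of [zP]. This gives the
    regularity, and also the projective dimension once
    [pdim R/P <= pdim R/I] is known. That inequality is
    [Tor_c(R/I, R/P) <> 0] for [c] the length of the Koszul resolution: the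
    product [g] of the variables outside [C] is not in [I], but [gP <= I] by
    minimality of [C].

    Minimal resolutions of [I] are obtained from mapping cones over the
    generators, by cancelling units. *)

(** * Homogeneous entries and monomial ideals *)

Section Homogeneity.
Context (k : fieldType) (n : nat).
Implicit Types (p q : {mpoly k[n]}) (d : nat).

Lemma homog_entryP d d' p :
  homog_entry d d' p <-> forall m, p@_m != 0 -> (mdeg m + d')%N = d.
Proof. by split=> h m; [rewrite -mcoeff_msupp|rewrite mcoeff_msupp]; apply: h. Qed.

Lemma homog_entry0 d d' : homog_entry d d' (0 : {mpoly k[n]}).
Proof. by apply/homog_entryP => m; rewrite mcoeff0 eqxx. Qed.

Lemma homog_entryD d d' p q :
  homog_entry d d' p -> homog_entry d d' q -> homog_entry d d' (p + q).
Proof.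
move=> hp hq m /msuppD_le; rewrite mem_cat => /orP[]; [exact: hp|exact: hq].
Qed.

Lemma homog_entryN d d' p : homog_entry d d' p -> homog_entry d d' (- p).
Proof. by move=> hp m; rewrite (perm_mem (msuppN p)); apply: hp. Qed.

Lemma homog_entry_sum d d' I (r : seq I) (P : pred I) (f : I -> {mpoly k[n]}) :
  (forall i, P i -> homog_entry d d' (f i)) ->
  homog_entry d d' (\sum_(i <- r | P i) f i).
Proof.
by move=> h; apply: big_ind => //; [exact: homog_entry0|move=> *; exact: homog_entryD].
Qed.

Lemma homog_entryM d d' d'' p q :
  homog_entry d d' p -> homog_entry d' d'' q -> homog_entry d d'' (p * q).
Proof.
move=> hp hq m /msuppM_le /allpairsP[[m1 m2] /= [h1 h2 ->]].
by rewrite mdegD -addnA (hq _ h2) (hp _ h1).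
Qed.

Lemma homog_entryX d m : homog_entry (mdeg m + d) d ('X_[m] : {mpoly k[n]}).
Proof. by move=> m'; rewrite msuppX inE => /eqP ->. Qed.

Lemma homog_entry1 d : homog_entry d d (1 : {mpoly k[n]}).
Proof. by move=> m; rewrite msupp1 inE => /eqP ->; rewrite mdeg0. Qed.

Lemma homog_entry_shift s d d' p :
  homog_entry (d + s) (d' + s) p <-> homog_entry d d' p.
Proof.
split=> h m /h; rewrite addnA; first by move/addIn.
by move=> <-.
Qed.

(** The component of degree [d - d'], in the two-degree convention of [homog_entry]: no subtraction
    occurs, and the component is zero when [d < d']. *)
Definition hpart d d' p : {mpoly k[n]} :=
  \sum_(m <- msupp p | (mdeg m + d')%N == d) p@_m *: 'X_[m].

Lemma mcoeff_hpart d d' p m :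
  (hpart d d' p)@_m = if (mdeg m + d')%N == d then p@_m else 0.
Proof.
rewrite /hpart big_mkcond raddf_sum /=.
rewrite (eq_bigr (fun i => if (i == m) && ((mdeg m + d')%N == d) then p@_m else 0));
  last first.
  move=> i _; case: (i =P m) => [->|/eqP ne] /=.
    by case: ifP => _; rewrite ?mcoeff0 // mcoeffZ mcoeffX eqxx mulr1.
  by case: ifP => _; rewrite ?mcoeff0 // mcoeffZ mcoeffX (negbTE ne) mulr0.
case: ifP => hm; last first.
  by rewrite big1 // => i _; rewrite andbF.
under eq_bigr do rewrite andbT.
case: (boolP (m \in msupp p)) => hs.
  rewrite (bigD1_seq m) ?msupp_uniq //= eqxx big1 ?addr0 // => i.
  by case: eqP.
by rewrite (memN_msupp_eq0 hs) big1 // => i _; case: ifP.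
Qed.

Lemma hpart_homog d d' p : homog_entry d d' (hpart d d' p).
Proof. by apply/homog_entryP => m; rewrite mcoeff_hpart; case: (_ =P d); rewrite ?eqxx. Qed.

Lemma hpart_id d d' p : homog_entry d d' p -> hpart d d' p = p.
Proof.
move=> /homog_entryP h; apply/mpolyP => m; rewrite mcoeff_hpart.
by case: eqP => // ne; apply/esym/eqP; apply: contra_notT ne; apply: h.
Qed.

Lemma hpart0 d d' p : (forall m, m \in msupp p -> (mdeg m + d')%N <> d) -> hpart d d' p = 0.
Proof.
move=> h; apply/mpolyP => m; rewrite mcoeff_hpart mcoeff0; case: eqP => // e.
by apply/eqP; rewrite mcoeff_eq0; apply/negP => /h.
Qed.

Fact hpart_is_additive d d' : zmod_morphism (hpart d d').
Proof.
move=> p q; apply/mpolyP => m; rewrite mcoeffB !mcoeff_hpart mcoeffB.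
by case: ifP; rewrite ?subr0.
Qed.
HB.instance Definition _ d d' :=
  GRing.isZmodMorphism.Build {mpoly k[n]} {mpoly k[n]} (hpart d d')
    (hpart_is_additive d d').

(** Multiplication by a homogeneous [q] shifts all degrees by the same amount, so it commutes with
    taking components; by linearity in [p] it is enough to treat monomials. *)
Lemma hpartM d d1 d0 p q :
  homog_entry d1 d0 q -> hpart d d0 (p * q) = hpart d d1 p * q.
Proof.
move=> hq; have hM m : hpart d d0 ((p@_m *: 'X_[m]) * q) = hpart d d1 (p@_m *: 'X_[m]) * q.
  have hs m' : m' \in msupp (p@_m *: 'X_[m] * q) -> (mdeg m' + d0 = mdeg m + d1)%N.
    move=> /msuppM_le /allpairsP[[m1 m2] /= [/msuppZ_le]].
    by rewrite msuppX inE => /eqP -> h2 ->; rewrite mdegD -addnA (hq _ h2).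
  have [e|ne] := eqVneq (mdeg m + d1)%N d.
    rewrite !hpart_id //.
      by move=> m' /msuppZ_le; rewrite msuppX inE => /eqP ->.
    by move=> m' /hs ->.
  rewrite !hpart0 ?mul0r // => m'.
    by move/msuppZ_le; rewrite msuppX inE => /eqP ->; apply/eqP.
  by move/hs => ->; apply/eqP.
rewrite [in LHS](mpolyE p) [in RHS](mpolyE p) mulr_suml !raddf_sum mulr_suml.
by apply: eq_bigr => m _; apply: hM.
Qed.

Lemma homog_entry_const d d' p : homog_entry d d' p -> p@_0%MM != 0 -> d = d'.
Proof. by move=> /homog_entryP h /h; rewrite mdeg0. Qed.

Lemma homog_entry_constE d p : homog_entry d d p -> p = (p@_0%MM)%:MP.
Proof.
move=> /homog_entryP h; apply/mpolyP => m; rewrite mcoeffC.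
case: (m =P 0%MM) => [->|ne]; first by rewrite mulr1.
rewrite mulr0; apply/eqP; apply: contra_notT ne => /h /eqP.
by rewrite -{2}[d]add0n eqn_add2r mdeg_eq0 => /eqP.
Qed.

Lemma homog_entry_const0 d d' p : homog_entry d d' p -> d <> d' -> p@_0%MM = 0.
Proof. by move=> h ne; apply/eqP; apply: contra_notT ne; apply: homog_entry_const. Qed.

Definition graded r s (dr : 'I_r -> nat) (ds : 'I_s -> nat)
    (A : 'M[{mpoly k[n]}]_(r, s)) :=
  forall a b, homog_entry (dr a) (ds b) (A a b).

Lemma graded_mul r s t dr ds dt (A : 'M_(r, s)) (B : 'M_(s, t)) :
  graded dr ds A -> graded ds dt B -> graded dr dt (A *m B).
Proof.
by move=> hA hB a b; rewrite mxE; apply: homog_entry_sum => i _; apply: homog_entryM.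
Qed.

Lemma rows_factor r s t (A : 'M[{mpoly k[n]}]_(r, t)) (B : 'M_(s, t)) :
  (forall a, exists w, row a A = w *m B) -> exists W, A = W *m B.
Proof.
move=> /fin_all_exists[w hw]; exists (\matrix_a w a).
by apply/row_matrixP => a; rewrite row_mul rowK.
Qed.

(** Each entry of [W] is replaced by its component of the required degree. The entries of [A] are
    homogeneous, so by [hpartM] the product does not change. *)
Lemma graded_factor r s t dr ds dt (A : 'M_(r, t)) (W : 'M_(r, s)) (B : 'M_(s, t)) :
  graded dr dt A -> graded ds dt B -> A = W *m B ->
  exists W', graded dr ds W' /\ A = W' *m B.
Proof.
move=> hA hB eA; exists (\matrix_(a, b) hpart (dr a) (ds b) (W a b)); split.
  by move=> a b; rewrite mxE; apply: hpart_homog.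
apply/matrixP => a b; rewrite mxE -(hpart_id (hA a b)) eA mxE raddf_sum.
by apply: eq_bigr => i _; rewrite mxE; apply: hpartM.
Qed.

End Homogeneity.
Arguments graded_mul {k n r s t dr ds dt A B} _ _.

(** * Monomial ideals as spans of sets of exponents *)

Section MonomialIdeals.
Context (k : fieldType) (n : nat).
Implicit Types (p q : {mpoly k[n]}) (Q : pred 'X_{1..n}).

(** The span of the monomials satisfying [Q], which is an ideal once [Q] is [upclosed]. Sums,
    intersections and monomial multiples of ideals thus become Boolean operations on exponents. *)
Definition mideal Q p := forall m, m \in msupp p -> Q m.

Definition upclosed Q := forall m m', Q m -> Q (m + m')%MM.

Lemma midealP Q p : mideal Q p <-> forall m, p@_m != 0 -> Q m.
Proof. by split=> h m; [rewrite -mcoeff_msupp|rewrite mcoeff_msupp]; apply: h. Qed.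

Lemma mideal0 Q : mideal Q 0.
Proof. by apply/midealP => m; rewrite mcoeff0 eqxx. Qed.

Lemma midealD Q p q : mideal Q p -> mideal Q q -> mideal Q (p + q).
Proof.
by move=> hp hq m /msuppD_le; rewrite mem_cat => /orP[]; [exact: hp|exact: hq].
Qed.

Lemma midealN Q p : mideal Q p -> mideal Q (- p).
Proof. by move=> hp m; rewrite (perm_mem (msuppN p)); apply: hp. Qed.

Lemma midealMl Q p q : upclosed Q -> mideal Q q -> mideal Q (p * q).
Proof.
move=> up hq m /msuppM_le /allpairsP[[m1 m2] /= [_ h2 ->]].
by rewrite addmC; apply/up/hq.
Qed.

Lemma mideal_sum Q I (r : seq I) (P : pred I) (f : I -> {mpoly k[n]}) :
  (forall i, P i -> mideal Q (f i)) -> mideal Q (\sum_(i <- r | P i) f i).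
Proof.
by move=> h; apply: big_ind => //; [exact: mideal0|move=> *; exact: midealD].
Qed.

Lemma mideal_hpart Q d d' p : mideal Q p -> mideal Q (hpart d d' p).
Proof.
move=> /midealP hp; apply/midealP => m; rewrite mcoeff_hpart; case: ifP => // _.
  exact: hp.
by rewrite eqxx.
Qed.

Lemma midealX Q m : mideal Q 'X_[m] <-> Q m.
Proof.
split=> [h|h m']; first by apply: h; rewrite msuppX inE.
by rewrite msuppX inE => /eqP ->.
Qed.

Lemma eq_mideal Q Q' : Q =1 Q' -> mideal Q = mideal Q'.
Proof.
move=> e; apply: functional_extensionality => p; apply: propositional_extensionality.
by split=> h m /h; rewrite e.
Qed.

Lemma midealU Q1 Q2 p : mideal (predU Q1 Q2) p <->
  exists a b, [/\ mideal Q1 a, mideal Q2 b & p = a + b].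
Proof.
split=> [h|[a [b [ha hb ->]]]]; last first.
  apply: midealD => m hm /=; apply/orP; [left; exact: ha|right; exact: hb].
pose a : {mpoly k[n]} := \sum_(m <- msupp p | Q1 m) p@_m *: 'X_[m].
pose b : {mpoly k[n]} := \sum_(m <- msupp p | ~~ Q1 m) p@_m *: 'X_[m].
exists a, b; split; last by rewrite {1}[p]mpolyE (bigID Q1).
  apply: mideal_sum => m hm m' /msuppZ_le.
  by rewrite msuppX inE => /eqP ->.
rewrite /b big_seq_cond; apply: mideal_sum => m /andP[hm1 hm2] m' /msuppZ_le.
rewrite msuppX inE => /eqP ->; move/h: hm1 => /= /orP[] //.
by rewrite (negbTE hm2).
Qed.

Lemma midealI Q1 Q2 p : mideal (predI Q1 Q2) p <-> mideal Q1 p /\ mideal Q2 p.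
Proof.
split=> [h|[h1 h2] m hm /=]; first by split=> m /h /andP[].
by rewrite h1 // h2.
Qed.

Lemma midealMX Q m p :
  mideal (fun m' => (m <= m')%MM && Q (m' - m)%MM) p <->
  exists q, mideal Q q /\ p = q * 'X_[m].
Proof.
split=> [h|[q [hq ->]] m']; last first.
  rewrite (perm_mem (msuppMX q m)) => /mapP[m1 h1 ->].
  by rewrite lem_addr addmC addmK; apply: hq.
exists (\sum_(m' <- msupp p) p@_m' *: 'X_[m' - m]); split.
  rewrite big_seq; apply: mideal_sum => m' /h /andP[_ h1] m1 /msuppZ_le.
  by rewrite msuppX inE => /eqP ->.
rewrite [LHS]mpolyE mulr_suml big_seq [RHS]big_seq; apply: eq_bigr => m' /h /andP[h1 _].
by rewrite -scalerAl -mpolyXD submK.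
Qed.

End MonomialIdeals.

(** * Graded free resolutions of ideals *)

Section GradedBlocks.
Context (k : fieldType) (n : nat).
Local Notation R := {mpoly k[n]}.

Definition cat_deg r s (d : 'I_r -> nat) (e : 'I_s -> nat) (x : 'I_(r + s)) : nat :=
  match split x with inl a => d a | inr b => e b end.

Lemma cat_degl r s (d : 'I_r -> nat) (e : 'I_s -> nat) a :
  cat_deg d e (lshift s a) = d a.
Proof. by rewrite /cat_deg (unsplitK (inl a)). Qed.

Lemma cat_degr r s (d : 'I_r -> nat) (e : 'I_s -> nat) b :
  cat_deg d e (rshift r b) = e b.
Proof. by rewrite /cat_deg (unsplitK (inr b)). Qed.

Lemma graded0 r s (d : 'I_r -> nat) (e : 'I_s -> nat) :
  graded d e (0 : 'M[R]_(r, s)).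
Proof. by move=> a b; rewrite mxE; apply: homog_entry0. Qed.

Lemma gradedN r s (d : 'I_r -> nat) (e : 'I_s -> nat) (A : 'M[R]_(r, s)) :
  graded d e A -> graded d e (- A).
Proof. by move=> h a b; rewrite mxE; apply/homog_entryN/h. Qed.

Lemma graded_row r s t (d : 'I_r -> nat) (e : 'I_s -> nat) (f : 'I_t -> nat)
    (A : 'M[R]_(r, s)) (B : 'M[R]_(r, t)) :
  graded d e A -> graded d f B -> graded d (cat_deg e f) (row_mx A B).
Proof.
move=> hA hB a b; rewrite -[b]splitK; case: (split b) => c /=.
  by rewrite cat_degl row_mxEl; apply: hA.
by rewrite cat_degr row_mxEr; apply: hB.
Qed.

Lemma graded_col r s t (d : 'I_r -> nat) (e : 'I_s -> nat) (f : 'I_t -> nat)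
    (A : 'M[R]_(r, t)) (B : 'M[R]_(s, t)) :
  graded d f A -> graded e f B -> graded (cat_deg d e) f (col_mx A B).
Proof.
move=> hA hB a b; rewrite -[a]splitK; case: (split a) => c /=.
  by rewrite cat_degl col_mxEu; apply: hA.
by rewrite cat_degr col_mxEd; apply: hB.
Qed.

Lemma graded_block r1 r2 s1 s2 (d1 : 'I_r1 -> nat) (d2 : 'I_r2 -> nat)
    (e1 : 'I_s1 -> nat) (e2 : 'I_s2 -> nat) (Aul : 'M[R]_(r1, s1))
    (Aur : 'M[R]_(r1, s2)) (Adl : 'M[R]_(r2, s1)) (Adr : 'M[R]_(r2, s2)) :
  graded d1 e1 Aul -> graded d1 e2 Aur -> graded d2 e1 Adl -> graded d2 e2 Adr ->
  graded (cat_deg d1 d2) (cat_deg e1 e2) (block_mx Aul Aur Adl Adr).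
Proof. by move=> h1 h2 h3 h4; apply: graded_col; apply: graded_row. Qed.

End GradedBlocks.

(** * Resolutions of ideals, lifting of chain maps, mapping cones *)

Section Resolutions.
Context (k : fieldType) (n : nat).
Local Notation R := {mpoly k[n]}.
Implicit Types (F A B C : free_seq k n) (I J : R -> Prop).

(* Here [F] resolves the submodule [I] of [R] itself, so that [F_0] maps onto [I];
   [quot_seq] below turns this into a resolution of [R/I]. *)
Record resolves I F : Prop := Resolves {
  rs_diff_graded : forall i,
    graded (@fdeg _ _ F i.+1) (@fdeg _ _ F i) (fdiff F i);
  rs_aug_graded : graded (@fdeg _ _ F 0) (fun=> 0%N) (faug F);
  rs_aug_im : forall p, I p <-> exists v : 'rV_(frank F 0), p = (v *m faug F) 0 0;
  rs_exact0 : forall v : 'rV_(frank F 0),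
    v *m faug F = 0 <-> exists w, v = w *m fdiff F 0;
  rs_exactS : forall i (v : 'rV_(frank F i.+1)),
    v *m fdiff F i = 0 <-> exists w, v = w *m fdiff F i.+1
}.

Arguments rs_diff_graded [I F] r i.
Arguments rs_aug_graded [I F] r.

Definition minimal_seq F := forall i a b, (fdiff F i a b)@_0%MM = 0.

Definition finite_seq F := exists N, forall i, (N <= i)%N -> frank F i = 0%N.

(** Regularity and projective dimension depend only on which degrees occur, so multiplicities are
    never tracked. *)
Definition has_degree F i d := exists a : 'I_(frank F i), fdeg a = d.

Lemma rs_complex0 I F : resolves I F -> fdiff F 0 *m faug F = 0.
Proof.
move=> rF; apply/row_matrixP => a; rewrite row_mul row0.
by apply/(rs_exact0 rF); exists (delta_mx 0 a); rewrite rowE.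
Qed.

Lemma rs_complexS I F i : resolves I F -> fdiff F i.+1 *m fdiff F i = 0.
Proof.
move=> rF; apply/row_matrixP => a; rewrite row_mul row0.
by apply/(rs_exactS rF); exists (delta_mx 0 a); rewrite rowE.
Qed.

Lemma rs_factor0 I F r (A : 'M_(r, frank F 0)) : resolves I F ->
  A *m faug F = 0 -> exists W, A = W *m fdiff F 0.
Proof.
move=> rF hA; apply: rows_factor => a; apply/(rs_exact0 rF).
by rewrite -row_mul hA row0.
Qed.

Lemma rs_factorS I F i r (A : 'M_(r, frank F i.+1)) : resolves I F ->
  A *m fdiff F i = 0 -> exists W, A = W *m fdiff F i.+1.
Proof.
move=> rF hA; apply: rows_factor => a; apply/(rs_exactS rF).
by rewrite -row_mul hA row0.
Qed.

Lemma rs_factor_aug I F r (A : 'cV_r) : resolves I F ->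
  (forall a, I (A a 0)) -> exists W, A = W *m faug F.
Proof.
move=> rF hA; apply: rows_factor => a; have [v hv] := (rs_aug_im rF _).1 (hA a).
by exists v; apply/matrixP => i j; rewrite !ord1 -hv mxE.
Qed.

Lemma rs_aug_mem I F (rF : resolves I F) a : I (faug F a 0).
Proof.
by apply/(rs_aug_im rF); exists (delta_mx 0 a); rewrite -rowE mxE.
Qed.

(* The condition on [faug] says that [f] covers an inclusion of ideals. *)
Record chain_map C A (f : forall i, 'M[R]_(frank C i, frank A i)) : Prop := ChainMap {
  cm_graded : forall i, graded (@fdeg _ _ C i) (@fdeg _ _ A i) (f i);
  cm_aug : f 0%N *m faug A = faug C;
  cm_diff : forall i, f i.+1 *m fdiff A i = fdiff C i *m f i
}.

Arguments cm_graded [C A f] c i.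

(** The lift is chosen by [epsilon], so that [lift_maps] is a plain recursion carrying no proofs;
    the value is arbitrary when no lift exists. *)
Definition graded_lift r s t (dr : 'I_r -> nat) (ds : 'I_s -> nat)
    (A : 'M[R]_(r, t)) (B : 'M[R]_(s, t)) : 'M[R]_(r, s) :=
  epsilon (inhabits 0) (fun W => graded dr ds W /\ A = W *m B).

Lemma graded_liftP r s t dr ds dt (A : 'M[R]_(r, t)) (B : 'M[R]_(s, t)) :
  graded dr dt A -> graded ds dt B -> (exists W, A = W *m B) ->
  graded dr ds (graded_lift dr ds A B) /\ A = graded_lift dr ds A B *m B.
Proof.
move=> hA hB [W hW].
apply: (epsilon_spec (inhabits 0) (fun W => graded dr ds W /\ A = W *m B)).
exact: graded_factor hW.
Qed.

Fixpoint lift_maps C A (i : nat) : 'M[R]_(frank C i, frank A i) :=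
  match i return 'M_(frank C i, frank A i) with
  | 0 => graded_lift (@fdeg _ _ C 0) (@fdeg _ _ A 0) (faug C) (faug A)
  | i.+1 => graded_lift (@fdeg _ _ C i.+1) (@fdeg _ _ A i.+1)
              (fdiff C i *m lift_maps C A i) (fdiff A i)
  end.

Lemma chain_map_exists I J C A : resolves J C -> resolves I A ->
  (forall p, J p -> I p) -> chain_map (lift_maps C A).
Proof.
move=> rC rA sub.
have h0 : graded (@fdeg _ _ C 0) (@fdeg _ _ A 0) (lift_maps C A 0) /\
    faug C = lift_maps C A 0 *m faug A.
  apply: (graded_liftP (rs_aug_graded rC) (rs_aug_graded rA)).
  exact: (rs_factor_aug rA) (fun a => sub _ (rs_aug_mem rC a)).
have hS i : graded (@fdeg _ _ C i) (@fdeg _ _ A i) (lift_maps C A i) ->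
    (exists W, fdiff C i *m lift_maps C A i = W *m fdiff A i) ->
    graded (@fdeg _ _ C i.+1) (@fdeg _ _ A i.+1) (lift_maps C A i.+1) /\
    fdiff C i *m lift_maps C A i = lift_maps C A i.+1 *m fdiff A i.
  move=> gi hW.
  exact: graded_liftP (graded_mul (rs_diff_graded rC i) gi) (rs_diff_graded rA i) hW.
(* The induction also carries the existence of the next factorization, because the chosen lift is
   known to be correct only when some lift exists. *)
have all i : graded (@fdeg _ _ C i) (@fdeg _ _ A i) (lift_maps C A i) /\
    exists W, fdiff C i *m lift_maps C A i = W *m fdiff A i.
  elim: i => [|i [gi /hS-/(_ gi)[gSi e]]].
    split; first exact: h0.1.
    apply: (rs_factor0 rA); rewrite -mulmxA -h0.2; exact: rs_complex0 rC.
  split=> //; apply: (rs_factorS rA).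
  by rewrite -mulmxA -e mulmxA (rs_complexS _ rC) mul0mx.
split=> [i||i]; [exact: (all i).1|exact/esym/h0.2|].
by have [g e] := all i; rewrite (hS i g e).2.
Qed.

(* The modules are [A_i + B_i + C_(i-1)]; when [C] resolves the intersection of
   the ideals resolved by [A] and [B], this resolves their sum. *)
Section Cone.
Context (A B C : free_seq k n).
Context (f : forall i, 'M[R]_(frank C i, frank A i)).
Context (g : forall i, 'M[R]_(frank C i, frank B i)).

Definition susp_rank i := if i is i'.+1 then frank C i' else 0%N.

Definition susp_deg i : 'I_(susp_rank i) -> nat :=
  match i return 'I_(susp_rank i) -> nat with
  | 0 => fun=> 0%N
  | i'.+1 => fun c => fdeg c
  end.

Definition susp_diff i : 'M[R]_(susp_rank i.+1, susp_rank i) :=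
  match i return 'M_(susp_rank i.+1, susp_rank i) with
  | 0 => 0
  | i'.+1 => - fdiff C i'
  end.

Definition cone_deg i : 'I_(frank A i + frank B i + susp_rank i) -> nat :=
  cat_deg (cat_deg (@fdeg _ _ A i) (@fdeg _ _ B i)) (@susp_deg i).

Definition cone := @FreeSeq k n
  (fun i => (frank A i + frank B i + susp_rank i)%N)
  cone_deg
  (fun i => block_mx (block_mx (fdiff A i) 0 0 (fdiff B i)) 0
                     (row_mx (f i) (- g i)) (susp_diff i))
  (col_mx (col_mx (faug A) (faug B)) 0).

Lemma cone_has_degree i d : has_degree cone i d <->
  [\/ has_degree A i d, has_degree B i d |
      exists2 i', i = i'.+1 & has_degree C i' d].
Proof.
split=> [[x <-]|].
  rewrite /= /cone_deg -[x]splitK; case: (split x) => [y|c].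
    rewrite cat_degl -[y]splitK; case: (split y) => [a|b].
      by rewrite cat_degl; constructor 1; exists a.
    by rewrite cat_degr; constructor 2; exists b.
  rewrite cat_degr; case: i x c => [x [] //|i x c].
  by constructor 3; exists i => //; exists c.
case=> [[a <-]|[b <-]|[i' ->{i} [c <-]]].
- by exists (lshift _ (lshift _ a)); rewrite /= /cone_deg !cat_degl.
- by exists (lshift _ (rshift _ b)); rewrite /= /cone_deg cat_degl cat_degr.
- by exists (@rshift _ (susp_rank i'.+1) c); rewrite /= /cone_deg cat_degr.
Qed.

Hypotheses (IA IB IC I : R -> Prop).
Hypotheses (rA : resolves IA A) (rB : resolves IB B) (rC : resolves IC C).
Hypotheses (cf : chain_map f) (cg : chain_map g).
Hypothesis inter : forall p, IC p <-> IA p /\ IB p.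
Hypothesis sum : forall p, I p <-> exists a b, [/\ IA a, IB b & p = a + b].

(** A diagram chase over the exact sequence [0 -> IC -> IA + IB -> I -> 0] with direct sum in the
    middle, first map [p |-> (p, -p)] and second map the addition. *)
Lemma cone_resolves : resolves I cone.
Proof.
have ext11 (M N : 'M[R]_1) : M 0 0 = N 0 0 -> M = N.
  by move=> e; apply/matrixP => x y; rewrite !ord1.
have mulS i (w : 'rV_(frank A i.+1)) (w' : 'rV_(frank B i.+1)) (c : 'rV_(susp_rank i.+1)) :
    row_mx (row_mx w w') c *m fdiff cone i =
    row_mx (row_mx (w *m fdiff A i + c *m f i) (w' *m fdiff B i - c *m g i))
           (c *m susp_diff i).
  rewrite /= mul_row_block mulmx0 add0r mul_row_block !mulmx0 addr0 add0r.
  by rewrite mul_mx_row add_row_mx mulmxN.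
have mul0 (w : 'rV_(frank A 0)) (w' : 'rV_(frank B 0)) (c : 'rV_(susp_rank 0)) :
    row_mx (row_mx w w') c *m faug cone = w *m faug A + w' *m faug B.
  by rewrite /= !mul_row_col mulmx0 addr0.
have susp2 i : susp_diff i.+1 *m susp_diff i = 0.
  case: i => [|i] /=; first by rewrite mulmx0.
  by rewrite mulNmx mulmxN opprK (rs_complexS _ rC).
split.
- move=> i; apply: graded_block.
  + by apply: graded_block; [exact: rs_diff_graded rA i|exact: graded0|exact: graded0|
                             exact: rs_diff_graded rB i].
  + exact: graded0.
  + apply: graded_row; first exact: cm_graded cf i.
    exact/gradedN/(cm_graded cg i).
  + case: i => [a [] //|i]; apply: gradedN; exact: rs_diff_graded rC i.
- apply: graded_col; last exact: graded0.
  by apply: graded_col; [exact: rs_aug_graded rA|exact: rs_aug_graded rB].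
- move=> p; rewrite sum; split.
    move=> [a [b [/(rs_aug_im rA)[v ->] /(rs_aug_im rB)[w ->] ->]]].
    by exists (row_mx (row_mx v w) 0); rewrite mul0 [in RHS]mxE.
  move=> [v ->].
  rewrite -(hsubmxK v) -(hsubmxK (lsubmx v)) mul0 mxE; do 2 eexists; split; last by [].
    by apply/(rs_aug_im rA); eexists.
  by apply/(rs_aug_im rB); eexists.
- move=> v; rewrite -(hsubmxK v) -(hsubmxK (lsubmx v)) mul0.
  set a := lsubmx (lsubmx v); set b := rsubmx (lsubmx v).
  split=> [e|[w]]; last first.
    rewrite -(hsubmxK w) -(hsubmxK (lsubmx w)) mulS => /eq_row_mx[/eq_row_mx[-> ->] _].
    rewrite mulmxBl mulmxDl -!mulmxA (rs_complex0 rA) (rs_complex0 rB) cf.(cm_aug).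
    by rewrite cg.(cm_aug) !mulmx0 add0r sub0r subrr.
  (* The images of [a] and [- b] agree and so lie in the intersection; a preimage [c] in [C]
     supplies the third component. *)
  have /(rs_aug_im rC)[c ec] : IC ((a *m faug A) 0 0).
    apply/inter; split; first by apply/(rs_aug_im rA); exists a.
    by apply/(rs_aug_im rB); exists (- b); rewrite mulNmx -(addr0_eq e) opprK.
  have {}ec : a *m faug A = c *m faug C by apply: ext11.
  have [a' ea'] : exists a', a - c *m f 0 = a' *m fdiff A 0.
    apply/(rs_exact0 rA).
    by rewrite mulmxBl ec -mulmxA cf.(cm_aug) subrr.
  have [b' eb'] : exists b', b + c *m g 0 = b' *m fdiff B 0.
    apply/(rs_exact0 rB).
    by rewrite mulmxDl -mulmxA cg.(cm_aug) -ec addrC.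
  exists (row_mx (row_mx a' b') c); rewrite mulS -ea' -eb' subrK addrK.
  by congr row_mx; apply/matrixP => ? [].
- move=> i v; rewrite -(hsubmxK v) -(hsubmxK (lsubmx v)) mulS.
  set a := lsubmx (lsubmx v); set b := rsubmx (lsubmx v); set c := rsubmx v.
  split=> [e|[w]]; last first.
    rewrite -(hsubmxK w) -(hsubmxK (lsubmx w)) mulS => /eq_row_mx[/eq_row_mx[-> ->] ->].
    rewrite mulmxBl mulmxDl -!mulmxA (rs_complexS _ rA) (rs_complexS _ rB) susp2.
    rewrite !mulmx0 add0r sub0r.
    rewrite cf.(cm_diff) cg.(cm_diff) /= mulNmx mulmxN subrr.
    by rewrite mulNmx mulmxN opprK addNr !row_mx0.
  move: e; rewrite -[0]row_mx0 -[0]row_mx0.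
  move/eq_row_mx => [/eq_row_mx[ea eb] ec].
  have [w ew] : exists w, c = w *m fdiff C i.
    (* In the lowest position [susp_diff] is zero and [ec] says nothing; there the cycle condition
       on [c] comes from [ea] composed with the augmentation of [A]. *)
    case: i v a b c ea eb ec => [|i] v a b c ea eb ec.
      apply/(rs_exact0 rC); rewrite -cf.(cm_aug) mulmxA.
      move/eqP: ea; rewrite addrC addr_eq0 => /eqP ->.
      by rewrite mulNmx -mulmxA (rs_complex0 rA) mulmx0 oppr0.
    apply/(rs_exactS rC); apply/eqP; rewrite -oppr_eq0 -mulmxN; exact/eqP.
  have [a' ea'] : exists a', a + w *m f i.+1 = a' *m fdiff A i.+1.
    by apply/(rs_exactS rA); rewrite mulmxDl -mulmxA cf.(cm_diff) mulmxA -ew.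
  have [b' eb'] : exists b', b - w *m g i.+1 = b' *m fdiff B i.+1.
    by apply/(rs_exactS rB); rewrite mulmxBl -mulmxA cg.(cm_diff) mulmxA -ew.
  exists (row_mx (row_mx a' b') (- w)).
  rewrite mulS -ea' -eb' /= !mulNmx mulmxN !opprK addrK.
  by rewrite subrK -ew.
Qed.

Lemma cone_finite : finite_seq A -> finite_seq B -> finite_seq C -> finite_seq cone.
Proof.
move=> [a ha] [b hb] [c hc]; exists (maxn (maxn a b) c.+1) => -[|i].
  by rewrite geq_max ltn0 andbF.
by rewrite !geq_max => /andP[/andP[/ha /= -> /hb ->] /hc ->].
Qed.

End Cone.

(** Multiplication by ['X_[m]] is injective, so the monomial multiple of an ideal has the same
    resolution up to a twist of the degrees and a new augmentation. *)
Definition shift_seq (m : 'X_{1..n}) F := @FreeSeq k n (frank F)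
  (fun i a => fdeg a + mdeg m)%N (fdiff F) (map_mx (fun p => p * 'X_[m]) (faug F)).

Lemma mulmx_map_mulr r s (q : R) (v : 'M[R]_(r, s)) (c : 'cV[R]_s) :
  v *m map_mx (fun p => p * q) c = map_mx (fun p => p * q) (v *m c).
Proof.
apply/matrixP => a b; rewrite !mxE mulr_suml; apply: eq_bigr => i _.
by rewrite mxE mulrA.
Qed.

Lemma mpolyX_neq0 (m : 'X_{1..n}) : ('X_[m] : R) != 0.
Proof.
apply/eqP => /mpolyP/(_ m); rewrite mcoeffX eqxx mcoeff0 => /eqP.
by rewrite oner_eq0.
Qed.

Lemma shift_seq_resolves I J m F : resolves I F ->
  (forall p, J p <-> exists q, I q /\ p = q * 'X_[m]) -> resolves J (shift_seq m F).
Proof.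
move=> rF hJ; split.
- move=> i a b; apply/homog_entry_shift; exact: (rs_diff_graded rF i a b).
- move=> a b; rewrite mxE; apply: (@homog_entryM _ _ _ (mdeg m)).
    rewrite -[mdeg m in X in homog_entry _ X]add0n.
    by apply/homog_entry_shift; exact: (rs_aug_graded rF a b).
  by move: (@homog_entryX k n 0 m); rewrite addn0.
- move=> p; rewrite hJ; split=> [[q [/(rs_aug_im rF)[v ->] ->]]|[v ->]].
    by exists v; rewrite mulmx_map_mulr [in RHS]mxE.
  rewrite mulmx_map_mulr mxE; eexists; split=> //.
  by apply/(rs_aug_im rF); eexists.
- move=> v; rewrite -(rs_exact0 rF) mulmx_map_mulr; split=> [/matrixP e|->].
    apply/matrixP => a b; move: (e a b); rewrite !mxE => /eqP.
    by rewrite mulf_eq0 (negbTE (mpolyX_neq0 m)) orbF => /eqP.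
  by apply/matrixP => a b; rewrite !mxE mul0r.
- exact: rs_exactS rF.
Qed.

Definition principal_seq (m : 'X_{1..n}) := @FreeSeq k n
  (fun i => if i is 0 then 1 else 0)%N (fun _ _ => mdeg m) (fun=> 0) (const_mx 'X_[m]).

Lemma principal_resolves I m :
  (forall p, I p <-> exists q, p = q * 'X_[m]) -> resolves I (principal_seq m).
Proof.
move=> hI.
have mulE (v : 'rV[R]_1) : v *m const_mx 'X_[m] = const_mx (v 0 0 * 'X_[m]) :> 'M_1.
  by apply/matrixP => a b; rewrite mxE big_ord1 !mxE !ord1.
split=> /=.
- by move=> i [].
- by move=> a b; rewrite mxE -[mdeg m]addn0; apply: homog_entryX.
- move=> p; rewrite hI; split=> [[q ->]|[v ->]].
    by exists (const_mx q); rewrite mulE !mxE.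
  by exists (v 0 0); rewrite mulE mxE.
- move=> v; rewrite mulE; split=> [/matrixP/(_ 0 0)|[w ->]].
    rewrite !mxE => /eqP; rewrite mulf_eq0 (negbTE (mpolyX_neq0 m)) orbF => /eqP e.
    by exists 0; rewrite mulmx0; apply/matrixP => a b; rewrite !ord1 e mxE.
  by rewrite mulmx0 mxE mul0r; apply/matrixP => a b; rewrite !mxE.
- move=> i v; split=> _; first by exists 0; apply/matrixP => ? [].
  by rewrite mulmx0.
Qed.

Lemma resolves_zero : resolves (fun p => p = 0) (zero_free_seq k n).
Proof.
split=> /=.
- by move=> i [].
- by move=> [].
- move=> p; split=> [->|[v ->]]; first by exists 0; rewrite mulmx0 mxE.
  by rewrite mulmx0 mxE.
- move=> v; split=> _; last by rewrite mulmx0.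
  by exists 0; apply/matrixP => ? [].
- move=> i v; split=> _; last by rewrite mulmx0.
  by exists 0; apply/matrixP => ? [].
Qed.

End Resolutions.
Arguments rs_diff_graded {k n I F} r i.
Arguments rs_aug_graded {k n I F} r.
Arguments cm_graded {k n C A f} c i.

(** * Cancelling units in a finite resolution *)

Section Minimization.
Context (k : fieldType) (n : nat).
Local Notation R := {mpoly k[n]}.

(** A graded free resolution of the submodule [M] by at most [N] free modules, unfolded from the
    front so that its first step can be modified separately. *)
Fixpoint resolvable (N r : nat) (d : 'I_r -> nat) (M : 'rV[R]_r -> Prop) : Prop :=
  match N with
  | 0 => forall v, M v -> v = 0
  | N.+1 => exists s (e : 'I_s -> nat) (A : 'M[R]_(s, r)),
      [/\ graded e d A, forall v, M v <-> exists w, v = w *m A &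
          resolvable N e (fun w => w *m A = 0)]
  end.

(** The kernel lies in the irrelevant ideal times the free module, that is, the rows of [A] generate
    their span minimally. *)
Definition min_kernel r s (A : 'M[R]_(s, r)) :=
  forall w : 'rV_s, w *m A = 0 -> forall a, (w 0 a)@_0%MM = 0.

Lemma resolvable_eq N r (d : 'I_r -> nat) (M M' : 'rV[R]_r -> Prop) :
  (forall v, M v <-> M' v) -> resolvable N d M -> resolvable N d M'.
Proof.
case: N => [|N] e /=; first by move=> h v /e; apply: h.
move=> [s [f [A [gA imA hA]]]]; exists s, f, A; split=> // v.
by rewrite -e.
Qed.

Lemma graded_id r (d : 'I_r -> nat) : graded d d (1%:M : 'M[R]_r).
Proof.
move=> a b; rewrite mxE; case: eqP => [->|_]; first exact: homog_entry1.
exact: homog_entry0.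
Qed.

Arguments graded_id {r} d.

(* If the entry [B b a] of a presentation of [ker A] is a unit, then row [a] of [A]
   is redundant, and the kernel of what remains of [A] is generated by the rows of
   the Schur complement of that entry. *)
Section Cancel.
Context (r s t : nat) (d : 'I_r -> nat) (e : 'I_s.+1 -> nat) (f : 'I_t.+1 -> nat).
Context (A : 'M[R]_(s.+1, r)) (B : 'M[R]_(t.+1, s.+1)) (a : 'I_s.+1) (b : 'I_t.+1).
Context (u : R).
Hypothesis uB : u * B b a = 1.
Hypothesis u_homog : homog_entry (e a) (f b) u.

Local Notation ea := (row a 1%:M : 'M[R]_(1, s.+1)).
Local Notation ca := (col a 1%:M : 'M[R]_(s.+1, 1)).
Local Notation J := (row' a 1%:M : 'M[R]_(s, s.+1)).
Local Notation P := (col' a 1%:M : 'M[R]_(s.+1, s)).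
Local Notation eb := (row b 1%:M : 'M[R]_(1, t.+1)).
Local Notation cb := (col b 1%:M : 'M[R]_(t.+1, 1)).
Local Notation K := (row' b 1%:M : 'M[R]_(t, t.+1)).
Local Notation L := (col' b 1%:M : 'M[R]_(t.+1, t)).

Lemma split_id m (i : 'I_m.+1) :
  1%:M = col i 1%:M *m row i 1%:M + col' i 1%:M *m row' i 1%:M :> 'M[R]_m.+1.
Proof.
rewrite -{1}[1%:M]mulmx1; apply/matrixP => x y.
rewrite !mxE (bigD1_ord i) //= big_ord1 !mxE; congr (_ + _).
by apply: eq_bigr => z _; rewrite !mxE.
Qed.

Lemma col'_row' m (i : 'I_m.+1) :
  col' i 1%:M *m row' i 1%:M = 1%:M - col i 1%:M *m row i 1%:M :> 'M[R]_m.+1.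
Proof. by apply/eqP; rewrite eq_sym subr_eq addrC -split_id. Qed.

Lemma row'_col' m (i : 'I_m.+1) : row' i 1%:M *m col' i 1%:M = 1%:M :> 'M[R]_m.
Proof.
apply/matrixP => x y; rewrite !mxE (bigD1 (lift i x)) //= !mxE eqxx mul1r.
rewrite (inj_eq lift_inj) big1 ?addr0 // => z ne.
by rewrite !mxE eq_sym (negbTE ne) mul0r.
Qed.

Lemma row_col' m (i : 'I_m.+1) : row i 1%:M *m col' i 1%:M = 0 :> 'M[R]_(1, m).
Proof.
apply/matrixP => x y; rewrite !mxE big1 // => z _; rewrite !mxE.
case: (i =P z) => [<-|_]; last by rewrite mul0r.
by rewrite (negbTE (neq_lift _ _)) mulr0.
Qed.

Lemma row'_col m (i : 'I_m.+1) : row' i 1%:M *m col i 1%:M = 0 :> 'M[R]_(m, 1).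
Proof.
apply/matrixP => x y; rewrite !mxE big1 // => z _; rewrite !mxE.
case: (z =P i) => [->|_]; last by rewrite mulr0.
by rewrite eq_sym (negbTE (neq_lift _ _)) mul0r.
Qed.

Local Notation beta := (eb *m B).

(** On row vectors, [pivot_mx] sends [w] to the multiple of row [b] of [B] having the same
    coordinate [a] as [w]. Subtracting it clears that coordinate, which [elim_mx] then deletes;
    [schur_mx] does this to the other rows of [B]. *)
Definition pivot_mx : 'M[R]_s.+1 := u *: (ca *m beta).
Definition elim_mx : 'M[R]_(s.+1, s) := (1%:M - pivot_mx) *m P.
Definition schur_mx : 'M[R]_(t, s) := K *m B *m elim_mx.
Local Notation Q := pivot_mx.
Local Notation E := elim_mx.

Lemma beta_ca : u *: (beta *m ca) = 1%:M.
Proof.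
rewrite -row_mul mul1mx colE mul1mx -colE; apply/matrixP => x y.
by rewrite !ord1 mxE [col _ _ _ _]mxE [row _ _ _ _]mxE uB mxE.
Qed.

Lemma pivot_ca : (1%:M - Q) *m ca = 0.
Proof. by rewrite mulmxBl mul1mx -scalemxAl -(mulmxA ca) scalemxAr beta_ca mulmx1 subrr. Qed.

Lemma beta_pivot : beta *m (1%:M - Q) = 0.
Proof. by rewrite mulmxBr mulmx1 -scalemxAr (mulmxA beta) scalemxAl beta_ca mul1mx subrr. Qed.

Lemma beta_E : beta *m E = 0.
Proof. by rewrite mulmxA beta_pivot mul0mx. Qed.

Lemma J_E : J *m E = 1%:M.
Proof.
rewrite mulmxA mulmxBr mulmx1 -scalemxAr (mulmxA _ ca) row'_col mul0mx scaler0 subr0.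
exact: row'_col'.
Qed.

Lemma E_J : E *m J = 1%:M - Q.
Proof.
by rewrite -mulmxA col'_row' mulmxBr mulmx1 (mulmxA _ ca) pivot_ca mul0mx subr0.
Qed.

Lemma L_schur : L *m schur_mx = B *m E.
Proof.
rewrite /schur_mx !mulmxA col'_row' !mulmxBl mul1mx -!mulmxA (mulmxA eb) beta_E.
by rewrite mulmx0 subr0.
Qed.

(** With [kernel_schur] and [kernel_inj], this makes deletion of coordinate [b] a bijection from the
    kernel of [B] to that of the Schur complement. For surjectivity: by [E_J], the image [y] of [x]
    padded by zero is a multiple of row [b] of [B], and this multiple, negated, is the missing
    coordinate. *)
Lemma schur_kernel (x : 'rV_t) : x *m schur_mx = 0 ->
  exists z, z *m B = 0 /\ x = z *m L.
Proof.
move=> hx; set y := x *m K *m B.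
have hy : y = (u *: (y *m ca)) *m eb *m B.
  have : y *m E *m J = 0.
    suff -> : y *m E = 0 by rewrite mul0mx.
    by rewrite -hx /y /schur_mx (mulmxA x) (mulmxA x K).
  rewrite -mulmxA E_J mulmxBr mulmx1 => /eqP; rewrite subr_eq0 => /eqP ey.
  by rewrite {1}ey /pivot_mx -!scalemxAr -!scalemxAl !mulmxA.
exists (x *m K - (u *: (y *m ca)) *m eb); split; first by rewrite mulmxBl -hy subrr.
by rewrite mulmxBl -!mulmxA row_col' !mulmx0 subr0 row'_col' mulmx1.
Qed.

Lemma kernel_schur (z : 'rV_t.+1) : z *m B = 0 -> z *m L *m schur_mx = 0.
Proof. by move=> hz; rewrite -mulmxA L_schur mulmxA hz mul0mx. Qed.

Lemma kernel_inj (z : 'rV_t.+1) : z *m B = 0 -> z *m L = 0 -> z = 0.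
Proof.
move=> hz hL; have ez : z = z *m cb *m eb.
  by rewrite -{1}[z]mulmx1 {1}(split_id b) mulmxDr !mulmxA hL mul0mx addr0.
suff zb : z *m cb = 0 by rewrite ez zb mul0mx.
have : z *m cb *m (u *: (beta *m ca)) = 0.
  by rewrite -scalemxAr !mulmxA -ez hz mul0mx scaler0.
by rewrite beta_ca mulmx1.
Qed.

Lemma graded_col'_id m (h : 'I_m.+1 -> nat) i :
  graded h (h \o lift i) (col' i 1%:M : 'M[R]_(m.+1, m)).
Proof. by move=> x y; rewrite mxE; exact: (graded_id h x (lift i y)). Qed.

Arguments graded_col'_id {m} h i.

Lemma graded_row'_id m (h : 'I_m.+1 -> nat) i :
  graded (h \o lift i) h (row' i 1%:M : 'M[R]_(m, m.+1)).
Proof. by move=> x y; rewrite mxE; exact: (graded_id h (lift i x) y). Qed.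

Arguments graded_row'_id {m} h i.

Lemma graded_schur : graded f e B -> graded (f \o lift b) (e \o lift a) schur_mx.
Proof.
move=> gB; have gQ : graded e e Q.
  rewrite /pivot_mx scalemxAl -row_mul mul1mx.
  apply: (graded_mul (ds := fun=> f b)) => x y; last by rewrite mxE; apply: gB.
  rewrite !mxE; case: (x =P a) => [->|_]; first by rewrite mulr1.
  by rewrite mulr0; exact: homog_entry0.
apply: graded_mul (graded_mul (graded_row'_id f b) gB) _.
apply: graded_mul _ (graded_col'_id e a) => x y; rewrite mxE.
apply: homog_entryD; first exact: (graded_id e x y).
by rewrite mxE; apply/homog_entryN/gQ.
Qed.

Lemma pivot_A : B *m A = 0 -> Q *m A = 0.
Proof. by move=> BA; rewrite -scalemxAl -(mulmxA ca) -(mulmxA eb) BA !mulmx0 scaler0. Qed.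

Lemma im_elim (w : 'rV_s.+1) : B *m A = 0 ->
  w *m A = (w *m E) *m (J *m A).
Proof.
move=> BA; rewrite [RHS]mulmxA -(mulmxA w E) E_J -mulmxA mulmxBl mul1mx pivot_A //.
by rewrite subr0.
Qed.

Lemma kernel_elim (x : 'rV_s) : B *m A = 0 ->
  (forall w : 'rV_s.+1, w *m A = 0 -> exists c, w = c *m B) ->
  x *m (J *m A) = 0 <-> exists c, x = c *m schur_mx.
Proof.
move=> BA kerA; split=> [|[c ->]].
  rewrite mulmxA => /kerA[c hc]; exists (c *m L).
  by rewrite -mulmxA L_schur mulmxA -hc -mulmxA J_E mulmx1.
rewrite -mulmxA -(mulmxA (K *m B)) (mulmxA E) E_J mulmxBl mul1mx pivot_A // subr0.
by rewrite -(mulmxA K) BA !mulmx0.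
Qed.

(** The two kernels are isomorphic by deletion of coordinate [b], so the resolution continues as
    before, except that its next map loses column [b]. *)
Lemma resolvable_schur N : resolvable N f (fun z => z *m B = 0) ->
  resolvable N (f \o lift b) (fun x => x *m schur_mx = 0).
Proof.
case: N => [|N] /= h.
  by move=> x /schur_kernel[z [/h -> ->]]; rewrite mul0mx.
case: h => q [g [C [gC imC hC]]]; exists q, g, (C *m L); split.
- exact: graded_mul gC (graded_col'_id f b).
- move=> x; split=> [/schur_kernel[z [/imC[w ->] ->]]|[w ->]].
    by exists w; rewrite mulmxA.
  by rewrite mulmxA; apply/kernel_schur/imC; exists w.
- move: hC; apply: resolvable_eq => w; rewrite mulmxA.
  split=> [->|h]; first by rewrite mul0mx.
  by apply: kernel_inj h; apply/imC; exists w.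
Qed.

End Cancel.
Arguments graded_row'_id {m} h i.

(** Induction on the number of generators: as long as the kernel has a coordinate with nonzero
    constant term, one generator is cancelled, and the length bound is kept. *)
Lemma resolvable_minimize N r (d : 'I_r -> nat) M : resolvable N.+1 d M ->
  exists s (e : 'I_s -> nat) (A : 'M[R]_(s, r)),
    [/\ graded e d A, forall v, M v <-> exists w, v = w *m A, min_kernel A &
        resolvable N e (fun w => w *m A = 0)].
Proof.
move=> [s [e [A [gA imA hA]]]]; elim: s => [|s IHs] in e A gA imA hA *.
  by exists 0%N, e, A; split=> // w _ [].
have [hmin|hmin] := excluded_middle_informative (min_kernel A).
  by exists s.+1, e, A.
have [w [a [wA wa]]] : exists (w : 'rV[R]_s.+1) (a : 'I_s.+1),
    w *m A = 0 /\ (w 0 a)@_0%MM <> 0.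
  apply: NNPP => h; apply: hmin => w wA a; apply: NNPP => wa.
  by apply: h; exists w, a.
(* With no further free module the kernel is zero, contradicting the nonzero coordinate of [w]. *)
case: N IHs hA {hmin} => [|N] IHs hA.
  by rewrite (hA w wA) mxE mcoeff0 in wa.
case: hA => t [f [B [gB kerA hB]]].
have [c wc] := (kerA w).1 wA.
(* The constant term of [w 0 a] is a combination of those in column [a] of [B], so one of the latter
   is nonzero. *)
have [b Bba] : exists b, (B b a)@_0%MM != 0.
  apply: NNPP => h; apply: wa; rewrite wc mxE raddf_sum big1 // => b _ /=.
  rewrite rmorphM /=; suff -> : (B b a)@_0%MM = 0 by rewrite mulr0.
  by apply/eqP; apply: contra_notT h => ?; exists b.
case: t => [|t] in f B gB kerA hB c wc b Bba *; first by case: b Bba.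
have fb : f b = e a := homog_entry_const (gB b a) Bba.
(* Since its source and target degrees agree, the entry equals its constant term, an invertible
   scalar. *)
have eBba : B b a = ((B b a)@_0%MM)%:MP.
  by apply: (@homog_entry_constE _ _ (e a)); rewrite -{1}fb; exact: gB.
pose u : R := ((B b a)@_0%MM)^-1%:MP.
have uB : u * B b a = 1 by rewrite eBba -mpolyCM mulVf.
have u_homog : homog_entry (e a) (f b) u.
  rewrite fb; move=> m; rewrite /u msuppC; case: ifP => // _.
  by rewrite inE => /eqP ->; rewrite mdeg0.
have BA : B *m A = 0.
  apply/row_matrixP => i; rewrite row_mul row0; apply/kerA.
  by exists (row i 1%:M); rewrite -row_mul mul1mx.
apply: (IHs (e \o lift a) (row' a 1%:M *m A)).
- exact: graded_mul (graded_row'_id _ _) gA.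
- move=> v; rewrite imA; split=> [[x ->]|[x ->]].
    by exists (x *m elim_mx B a b u); apply: im_elim.
  by exists (x *m row' a 1%:M); rewrite mulmxA.
- exists t, (f \o lift b), (schur_mx B a b u); split.
  + exact: graded_schur.
  + by move=> x; apply: kernel_elim => // w' /kerA.
  + exact: resolvable_schur.
Qed.

(** * Assembling a minimal resolution by iterated syzygies *)

Record cover (r : nat) := Cover {
  cv_rank : nat;
  cv_deg : 'I_cv_rank -> nat;
  cv_mx : 'M[R]_(cv_rank, r)
}.

(** What is still to be resolved, with a length bound. Bundling the rank makes passage to syzygies a
    self-map of [state], which can be iterated. *)
Record state := State {
  st_len : nat;
  st_rank : nat;
  st_deg : 'I_st_rank -> nat;
  st_mod : 'rV[R]_st_rank -> Prop
}.

Definition st_resolvable S := resolvable (st_len S) (@st_deg S) (@st_mod S).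

Definition cover_next r (N : nat) (c : cover r) : state :=
  @State N.-1 (cv_rank c) (@cv_deg _ c) (fun w => w *m cv_mx c = 0).

(** The last clause makes the construction stop: when the length bound is used up, the submodule is
    zero and its cover must be empty. *)
Definition good_cover S (c : cover (st_rank S)) :=
  [/\ graded (@cv_deg _ c) (@st_deg S) (cv_mx c),
      forall v, st_mod v <-> exists w, v = w *m cv_mx c,
      min_kernel (cv_mx c),
      st_resolvable (cover_next (st_len S) c) &
      st_len S = 0%N -> cv_rank c = 0%N].

Lemma good_cover_exists S : st_mod (s := S) 0 -> st_resolvable S ->
  exists c, good_cover (S := S) c.
Proof.
case: S => [[|N] r d M] /= M0.
  move=> h; exists (@Cover r 0 (fun=> 0%N) 0); split=> //=.
  - by case.
  - move=> v; split=> [/h ->|[w ->]]; first by exists 0; rewrite mulmx0.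
    by rewrite mulmx0.
  - by move=> w _ [].
  - by move=> w _; apply/matrixP => ? [].
by move=> /resolvable_minimize[s [e [A [h1 h2 h3 h4]]]]; exists (Cover e A).
Qed.

Definition best_cover S : cover (st_rank S) :=
  epsilon (inhabits (Cover (fun=> 0%N) (0 : 'M_(0, _)))) (@good_cover S).

Lemma best_coverP S : st_mod (s := S) 0 -> st_resolvable S -> good_cover (best_cover S).
Proof. by move=> M0 /(good_cover_exists M0); apply: epsilon_spec. Qed.

Definition next_state S := cover_next (st_len S) (best_cover S).

Definition nth_state S i := iter i next_state S.

Definition min_seq N (I : R -> Prop) : free_seq k n :=
  let S := @State N 1 (fun=> 0%N) (fun v => I (v 0 0)) in
  @FreeSeq k n
    (fun i => cv_rank (best_cover (nth_state S i)))
    (fun i => @cv_deg _ (best_cover (nth_state S i)))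
    (fun i => cv_mx (best_cover (nth_state S i.+1)))
    (cv_mx (best_cover (nth_state S 0))).

(** Each cover generates the kernel of the one before, which gives exactness; [min_kernel] of that
    earlier cover gives minimality; the length bound drops at each step, which gives finiteness. *)
Lemma min_seqP N (I : R -> Prop) : I 0 ->
  resolvable N (fun=> 0%N) (fun v : 'rV_1 => I (v 0 0)) ->
  [/\ resolves I (min_seq N I), minimal_seq (min_seq N I) & finite_seq (min_seq N I)].
Proof.
move=> I0 hI; set S := @State N 1 (fun=> 0%N) (fun v => I (v 0 0)).
have hS i : st_mod (s := nth_state S i) 0 /\ st_resolvable (nth_state S i).
  elim: i => [|i [h1 h2]]; first by split=> //=; rewrite mxE.
  by split; [rewrite /= mul0mx|case: (best_coverP h1 h2)].
have good i := best_coverP (hS i).1 (hS i).2.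
have len i : st_len (nth_state S i) = (N - i)%N.
  by elim: i => [|i IH]; rewrite ?subn0 // subnS -IH.
split.
- split.
  + by move=> i; case: (good i.+1).
  + by case: (good 0%N).
  + move=> p; case: (good 0%N) => _ /(_ (const_mx p)) /= im _ _ _.
    rewrite mxE in im; rewrite im; split=> -[v ev]; exists v.
      by rewrite -ev mxE.
    by apply/matrixP => x y; rewrite !ord1 mxE ev.
  + by case: (good 1%N).
  + by move=> i; case: (good i.+2).
- move=> i a b; case: (good i) => _ _ hmin _ _; case: (good i.+1) => _ im _ _ _.
  have := hmin (row a (fdiff (min_seq N I) i)) _ b; rewrite mxE; apply.
  by apply/im; exists (row a 1%:M); rewrite -row_mul mul1mx.
- exists N => i hi; case: (good i) => _ _ _ _; apply.
  by rewrite len; apply/eqP.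
Qed.

Lemma resolves_resolvable I F N : resolves I F ->
  (forall i, (N <= i)%N -> frank F i = 0%N) ->
  resolvable N (fun=> 0%N) (fun v : 'rV_1 => I (v 0 0)).
Proof.
move=> rF hN.
have mul0 r s (w : 'rV[R]_r) (A : 'M_(r, s)) : r = 0%N -> w *m A = 0.
  move=> r0; apply/matrixP => x y; rewrite !mxE big1 // => j _.
  by move: (ltn_ord j); rewrite [X in (_ < X)%N]r0.
have rec m i : (i + m.+2 = N)%N ->
    resolvable m (@fdeg _ _ F i.+1) (fun w : 'rV_(frank F i.+1) => w *m fdiff F i = 0).
  elim: m i => [|m IH] i hi /=.
    by move=> v /(rs_exactS rF)[w ->]; apply/mul0/hN; rewrite -hi addn2.
  exists (frank F i.+2), (@fdeg _ _ F i.+2), (fdiff F i.+1); split.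
  - exact: rs_diff_graded rF _.
  - by move=> v; apply: (rs_exactS rF).
  - by apply: IH; rewrite addSnnS.
case: N hN rec => [|[|N]] hN rec /=.
- move=> v /(rs_aug_im rF)[w ew]; apply/matrixP => x y; rewrite !ord1 ew.
  by rewrite mul0 ?hN.
- exists (frank F 0), (@fdeg _ _ F 0), (faug F); split.
  + exact: rs_aug_graded rF.
  + move=> v; rewrite (rs_aug_im rF); split=> -[w ew]; exists w; last by rewrite ew.
    by apply/matrixP => x y; rewrite !ord1.
  + by move=> v /(rs_exact0 rF)[w ->]; apply/mul0/hN.
- exists (frank F 0), (@fdeg _ _ F 0), (faug F); split.
  + exact: rs_aug_graded rF.
  + move=> v; rewrite (rs_aug_im rF); split=> -[w ew]; exists w; last by rewrite ew.
    by apply/matrixP => x y; rewrite !ord1.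
  + exists (frank F 1), (@fdeg _ _ F 1), (fdiff F 0); split.
    * exact: rs_diff_graded rF _.
    * by move=> v; apply: (rs_exact0 rF).
    * exact: rec.
Qed.

End Minimization.

(** * Comparison of minimal resolutions *)

Section Quotients.
Context (k : fieldType) (n : nat).
Local Notation R := {mpoly k[n]}.
Implicit Types (F K : free_seq k n) (I : R -> Prop).

(** The ring is prepended, so [F_i] moves to homological degree [i + 1] and the augmentation of [F]
    becomes the first differential. *)
Definition quot_seq F := @FreeSeq k n
  (fun i => if i is i'.+1 then frank F i' else 1%N)
  (fun i => match i return 'I_(if i is i'.+1 then frank F i' else 1%N) -> nat with
            | 0 => fun=> 0%N
            | i'.+1 => fun a => fdeg a
            end)
  (fun i => match i return 'M[R]_(frank F i, if i is i'.+1 then frank F i' else 1%N) with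
            | 0 => faug F
            | i'.+1 => fdiff F i'
            end)
  (const_mx 1).

Lemma quot_seq_resolution I F : resolves I F -> minimal_seq F ->
  (forall a, (faug F a 0)@_0%MM = 0) ->
  minimal_graded_free_resolution I (quot_seq F).
Proof.
move=> rF minF minA.
have mul1 (v : 'rV[R]_1) : (v *m const_mx 1) 0 0 = v 0 0.
  by rewrite mxE big_ord1 mxE mulr1.
split.
- by case=> [|i]; [exact: rs_aug_graded rF|exact: rs_diff_graded rF i].
- by move=> a; rewrite mxE; exact: homog_entry1.
- move=> p; exists (const_mx p); rewrite mul1 mxE subrr.
  by apply/(rs_aug_im rF); exists 0; rewrite mul0mx mxE.
- move=> v; rewrite mul1 (rs_aug_im rF); split=> -[w ew]; exists w; last by rewrite ew.
  by apply/matrixP => x y; rewrite !ord1.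
- by case=> [|i] v; [apply: (rs_exact0 rF)|apply: (rs_exactS rF)].
- by case=> [|i] a b; [rewrite ord1; apply: minA|apply: minF].
Qed.

Section Comparison.
Context (Q : pred 'X_{1..n}) (upQ : upclosed Q) (F F' : free_seq k n).
Local Notation I := (@mideal k n Q).
Hypotheses (resF : minimal_graded_free_resolution I F)
           (resF' : minimal_graded_free_resolution I F').

(** The augmentation of a resolution of [R/I] is only a lift to [R] of a map to [R/I], so
    augmentations are compared modulo [I]. *)
Definition congr_mod r (V W : 'cV[R]_r) := forall a, I ((V - W) a 0).

Lemma congr_mod_mull r s (A : 'M_(s, r)) (V W : 'cV_r) :
  congr_mod V W -> congr_mod (A *m V) (A *m W).
Proof.
move=> h a; rewrite -mulmxBr mxE; apply: mideal_sum => b _; exact: midealMl.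
Qed.

Lemma congr_mod_trans r (V W X : 'cV_r) :
  congr_mod V W -> congr_mod W X -> congr_mod V X.
Proof.
move=> h1 h2 a; rewrite -(subrK W V) -addrA mxE; apply: midealD => //.
Qed.

Lemma congr_mod_mem r (V W : 'cV_r) :
  congr_mod V W -> (forall a, I (W a 0)) -> forall a, I (V a 0).
Proof. by move=> h1 h2 a; rewrite -(subrK W V) mxE; apply: midealD. Qed.

Lemma aug_lift (E E' : free_seq k n) (resE : minimal_graded_free_resolution I E)
    (resE' : minimal_graded_free_resolution I E') :
  exists f : 'M_(frank E 0, frank E' 0),
    graded (@fdeg _ _ E 0) (@fdeg _ _ E' 0) f /\ congr_mod (faug E) (f *m faug E').
Proof.
have /fin_all_exists[v hv] a := mr_aug_surj resE' (faug E a 0).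
exists (\matrix_(a, b) hpart (fdeg a) (fdeg b) (v a 0 b)); split.
  by move=> a b; rewrite mxE; apply: hpart_homog.
move=> a; have := @mideal_hpart _ _ _ (fdeg a) 0 _ (hv a).
rewrite raddfB /= (hpart_id (@mr_aug_graded _ _ _ _ resE a)).
suff -> : hpart (fdeg a) 0 ((v a *m faug E') 0 0) =
    (\matrix_(x, y) hpart (fdeg x) (fdeg y) (v x 0 y) *m faug E') a 0.
  by rewrite [((_ - _) : 'cV__) a 0]mxE [(- _ : 'cV__) a 0]mxE.
rewrite !mxE [LHS]raddf_sum; apply: eq_bigr => b _; rewrite mxE.
exact/hpartM/(@mr_aug_graded _ _ _ _ resE').
Qed.

Lemma mr_factor0 E r (A : 'M_(r, frank E 0)) : minimal_graded_free_resolution I E ->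
  (forall a, I ((A *m faug E) a 0)) -> exists W, A = W *m fdiff E 0.
Proof.
move=> rE hA; apply: rows_factor => a; apply/(mr_exact0 rE).
by rewrite -row_mul mxE.
Qed.

Lemma mr_factorS E i r (A : 'M_(r, frank E i.+1)) : minimal_graded_free_resolution I E ->
  A *m fdiff E i = 0 -> exists W, A = W *m fdiff E i.+1.
Proof.
move=> rE hA; apply: rows_factor => a; apply/(mr_exactS rE).
by rewrite -row_mul hA row0.
Qed.

Lemma mr_complex0 E (rE : minimal_graded_free_resolution I E) a :
  I ((fdiff E 0 *m faug E) a 0).
Proof.
have /(mr_exact0 rE) : exists w, row a (fdiff E 0) = w *m fdiff E 0.
  by exists (delta_mx 0 a); rewrite rowE.
by rewrite -row_mul mxE.
Qed.

Lemma mr_complexS E i (rE : minimal_graded_free_resolution I E) :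
  fdiff E i.+1 *m fdiff E i = 0.
Proof.
apply/row_matrixP => a; rewrite row_mul row0.
by apply/(mr_exactS rE); exists (delta_mx 0 a); rewrite rowE.
Qed.

(** Lifts in both directions together with a homotopy [h]. The last equation is the homotopy
    relation composed with the differential, which removes the term coming from the previous
    homotopy; this is the form that passes from [i] to [i + 1]. *)
Definition comparison i := exists (f : 'M_(frank F i, frank F' i))
    (g : 'M_(frank F' i, frank F i)) (h : 'M_(frank F i, frank F i.+1)),
  [/\ graded (@fdeg _ _ F i) (@fdeg _ _ F' i) f,
      exists f', fdiff F i *m f = f' *m fdiff F' i,
      exists g', fdiff F' i *m g = g' *m fdiff F i,
      forall a b, ((f *m g - 1%:M) a b)@_0%MM = 0 &
      fdiff F i *m (f *m g - 1%:M) = fdiff F i *m h *m fdiff F i].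

Lemma mulmx_const0 r s t (A : 'M[R]_(r, s)) (B : 'M[R]_(s, t)) a b :
  (forall x y, (A x y)@_0%MM = 0) \/ (forall x y, (B x y)@_0%MM = 0) ->
  ((A *m B) a b)@_0%MM = 0.
Proof.
move=> h; rewrite mxE raddf_sum big1 // => c _; rewrite /= rmorphM /=.
by case: h => ->; rewrite ?mulr0 ?mul0r.
Qed.

Lemma comparison_exists i : comparison i.
Proof.
elim: i => [|i [f [g [h [gf [f' ef] [g' eg] _ ehd]]]]].
  have [f [gf cf]] := aug_lift resF resF'; have [g [_ cg]] := aug_lift resF' resF.
  have csym r (V W : 'cV[R]_r) : congr_mod V W -> congr_mod W V.
    by move=> c a; rewrite -opprB mxE; apply/midealN/c.
  have [h eh] : exists h, f *m g - 1%:M = h *m fdiff F 0.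
    apply: (mr_factor0 resF) => a; rewrite mulmxBl mul1mx -mulmxA.
    apply: (csym _ _ _ (congr_mod_trans cf _)); exact: congr_mod_mull.
  exists f, g, h; split=> //.
  - apply: (mr_factor0 resF') => a; rewrite -mulmxA.
    apply: (congr_mod_mem (congr_mod_mull (csym _ _ _ cf))); exact: mr_complex0.
  - apply: (mr_factor0 resF) => a; rewrite -mulmxA.
    apply: (congr_mod_mem (congr_mod_mull (csym _ _ _ cg))); exact: mr_complex0.
  - move=> a b; rewrite eh; apply: mulmx_const0; right; exact: mr_minimal resF _.
  - by rewrite eh mulmxA.
have [f1 [gf1 ef1]] := graded_factor (graded_mul (@mr_diff_graded _ _ _ _ resF i) gf)
  (@mr_diff_graded _ _ _ _ resF' i) ef.
have [h1 eh1] : exists h1, f1 *m g' - 1%:M - fdiff F i *m h = h1 *m fdiff F i.+1.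
  apply: (mr_factorS resF); rewrite mulmxBl -ehd mulmxBl mul1mx -mulmxA -eg mulmxA -ef1.
  by rewrite mulmxBr mulmx1 mulmxA subrr.
(* The usual homotopy formula: each term has a factor from the minimal [F], so no entry has a
   constant term. *)
have e1 : f1 *m g' - 1%:M = fdiff F i *m h + h1 *m fdiff F i.+1.
  by rewrite -eh1 [RHS]addrC subrK.
exists f1, g', h1; split=> //.
- by apply: (mr_factorS resF'); rewrite -mulmxA -ef1 mulmxA (mr_complexS _ resF) mul0mx.
- by apply: (mr_factorS resF); rewrite -mulmxA -eg mulmxA (mr_complexS _ resF') mul0mx.
- move=> a b; rewrite e1 mxE raddfD /= !mulmx_const0 ?addr0 //.
    by right; exact: mr_minimal resF _.
  by left; exact: mr_minimal resF _.
- by rewrite e1 mulmxDr mulmxA (mr_complexS _ resF) mul0mx add0r mulmxA.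
Qed.

(** Modulo the irrelevant ideal [f *m g] is the identity, so row [a] of [f] has an entry with
    nonzero constant term, and such an entry joins generators of equal degree. *)
Lemma degree_transfer i d : has_degree F i d -> has_degree F' i d.
Proof.
move=> [a <-]; have [f [g [h [gf _ _ c0 _]]]] := comparison_exists i.
have : ((f *m g) a a)@_0%MM != 0.
  move/eqP: (c0 a a); rewrite !mxE eqxx raddfB /= subr_eq0 => /eqP ->.
  by rewrite mcoeff1 eqxx oner_eq0.
rewrite mxE raddf_sum /= => /eqP ne; apply: NNPP => nd; apply: ne.
apply: big1 => b _; rewrite rmorphM /= (homog_entry_const0 (gf a b)) ?mul0r // => e.
by apply: nd; exists b.
Qed.

End Comparison.

(** * A lower bound for the length from nonvanishing Tor *)

Section TorBound.
Context (F K : free_seq k n).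
Hypothesis exF : forall i (v : 'rV_(frank F i.+1)),
  v *m fdiff F i = 0 <-> exists w, v = w *m fdiff F i.+1.
Hypothesis exK : forall i (v : 'rV_(frank K i.+1)),
  v *m fdiff K i = 0 <-> exists w, v = w *m fdiff K i.+1.

(* In terms of the double complex [K (x) F], whose elements of bidegree [(i, j)]
   are matrices, this is the zigzag from [F] to [K] computing [Tor]; it breaks
   off because [F] vanishes in degree [i + 1 + j]. *)
Lemma tor_zigzag i j (Y : 'M_(frank K i.+1, frank F j))
    (Y' : 'M_(frank K i, frank F j.+1)) :
  frank F (i.+1 + j) = 0%N -> (fdiff K i)^T *m Y = Y' *m fdiff F j ->
  exists W0 W1, Y = (fdiff K i.+1)^T *m W0 + W1 *m fdiff F j.
Proof.
have fF l r (A : 'M_(r, frank F l.+1)) : A *m fdiff F l = 0 ->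
    exists W, A = W *m fdiff F l.+1.
  by move=> hA; apply: rows_factor => a; apply/exF; rewrite -row_mul hA row0.
have fK l r (A : 'M_(frank K l.+1, r)) : (fdiff K l)^T *m A = 0 ->
    exists W, A = (fdiff K l.+1)^T *m W.
  move=> hA; have [W hW] : exists W, A^T = W *m fdiff K l.+1.
    apply: rows_factor => a; apply/exK; rewrite -row_mul.
    by rewrite -[fdiff K l]trmxK -trmx_mul hA trmx0 row0.
  by exists W^T; rewrite -trmx_mul -hW trmxK.
have dF l : fdiff F l.+1 *m fdiff F l = 0.
  apply/row_matrixP => a; rewrite row_mul row0; apply/exF.
  by exists (delta_mx 0 a); rewrite rowE.
have dK l : (fdiff K l)^T *m (fdiff K l.+1)^T = 0.
  rewrite -trmx_mul; suff -> : fdiff K l.+1 *m fdiff K l = 0 by rewrite trmx0.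
  apply/row_matrixP => a; rewrite row_mul row0; apply/exK.
  by exists (delta_mx 0 a); rewrite rowE.
elim: i j Y Y' => [|i IH] j Y Y' F0 hY.
  have /fK[W ->] : (fdiff K 0)^T *m Y = 0.
    rewrite hY; apply/matrixP => x y; rewrite !mxE big1 // => z _.
    by move: (ltn_ord z); rewrite [X in (_ < X)%N]F0.
  by exists W, 0; rewrite mul0mx addr0.
(* Applying [K] once more kills the left side of [hY], so [Y'] starts a zigzag in [F]-degree [j + 1]
   with the same total degree. *)
have /fF[Y'' hY''] : (fdiff K i)^T *m Y' *m fdiff F j = 0.
  by rewrite -mulmxA -hY mulmxA dK mul0mx.
have [|W0 [W1 eY']] := IH j.+1 Y' Y'' _ hY''; first by rewrite -addSnnS.
have /fK[W eW] : (fdiff K i.+1)^T *m (Y - W0 *m fdiff F j) = 0.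
  rewrite mulmxBr hY eY' mulmxDl -(mulmxA W1) dF mulmx0 addr0 mulmxA subrr //.
by exists W, W0; rewrite -eW subrK.
Qed.

End TorBound.

Lemma quot_seq_exact I F i (v : 'rV_(frank (quot_seq F) i.+1)) : resolves I F ->
  v *m fdiff (quot_seq F) i = 0 <-> exists w, v = w *m fdiff (quot_seq F) i.+1.
Proof.
by move=> rF; case: i v => [|i] v; [apply: (rs_exact0 rF)|apply: (rs_exactS rF)].
Qed.

(** The class of [g] times a generator at the end of [quot_seq K] is a cycle modulo [I], giving an
    element of [Tor_(c+1)(R/J, R/I)]. If [F_c] were zero, the zigzag would make it a boundary modulo
    [I]; as [K] ends there, [g] would lie in [I]. *)
Lemma pdim_lower_bound I J F K c (g : R) : resolves I F -> resolves J K ->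
  (forall a b, I (fdiff (quot_seq K) c a b * g)) -> ~ I g ->
  frank K c <> 0%N -> frank K c.+1 = 0%N -> frank F c <> 0%N.
Proof.
move=> rF rK hg ng Kc Kc1 Fc; apply: ng.
case: (posnP (frank K c)) => [//|c_gt0].
pose top : 'I_(frank (quot_seq K) c.+1) := Ordinal c_gt0.
pose Y : 'M[R]_(frank (quot_seq K) c.+1, frank (quot_seq F) 0) :=
  \matrix_(a, b) ((a == top)%:R * g).
have [Y' eY'] : exists Y', (fdiff (quot_seq K) c)^T *m Y = Y' *m fdiff (quot_seq F) 0.
  apply: (rs_factor_aug rF) => b; rewrite mxE (bigD1 top) //= big1 ?addr0.
    by rewrite !mxE eqxx mul1r.
  by move=> a ne; rewrite !mxE (negbTE ne) mul0r mulr0.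
have := tor_zigzag (fun i v => quot_seq_exact v rF) (fun i v => quot_seq_exact v rK) _ eY'.
move=> [|W0 [W1 eY]]; first by rewrite addn0.
apply/(rs_aug_im rF); exists (row top W1); rewrite -row_mul mxE.
move/matrixP: eY => /(_ top 0); rewrite [Y _ _]mxE eqxx mul1r => ->.
rewrite mxE [X in X + _]mxE big1 ?add0r // => z _.
by move: (ltn_ord z); rewrite [X in (_ < X)%N]Kc1.
Qed.

End Quotients.

(** * Adjoining a variable *)

Section BaseChange.
Context (k : fieldType) (n : nat).
Local Notation R := {mpoly k[n]}.
Local Notation S := {mpoly k[n.+1]}.
Local Notation z := (@ord_max n).
Implicit Types (p : S) (q : R) (Q : pred 'X_{1..n}).

Definition mnmrestr (m : 'X_{1..n.+1}) : 'X_{1..n} :=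
  [multinom m (widen_ord (leqnSn n) i) | i < n].

Lemma mnmrestrK m : (mnmwiden (mnmrestr m) + U_(z) *+ m z)%MM = m.
Proof.
apply/mnmP => i; rewrite mnmDE mulmnE mnm1E.
have [<-|ne] := eqVneq z i; first by rewrite mnmwiden_ordmax mul1n.
case: (unliftP z i) => [j ej|ei]; last by rewrite ei eqxx in ne.
have -> : i = widen_ord (leqnSn n) j by rewrite ej; apply: val_inj; exact: lift_max.
by rewrite mnmwiden_widen mnmE addn0.
Qed.

Lemma mnmrestr_widen m j : mnmrestr (mnmwiden m + U_(z) *+ j)%MM = m.
Proof.
apply/mnmP => i; rewrite mnmE mnmDE mulmnE mnm1E mnmwiden_widen.
by rewrite -val_eqE /= gtn_eqF ?ltn_ord // addn0.
Qed.

Lemma mnmrestrB m : mnmrestr (m - U_(z))%MM = mnmrestr m.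
Proof.
by apply/mnmP => i; rewrite !mnmE -val_eqE /= gtn_eqF ?ltn_ord // subn0.
Qed.

Lemma mnmwiden_max m j : (mnmwiden m + U_(z) *+ j)%MM z = j.
Proof. by rewrite mnmDE mulmnE mnm1E eqxx mnmwiden_ordmax mul1n. Qed.

Lemma mdeg_mnmwiden (m : 'X_{1..n}) : mdeg (mnmwiden m) = mdeg m.
Proof.
rewrite !mdegE big_ord_recr /= mnmwiden_ordmax addn0.
by apply: eq_bigr => i _; rewrite mnmwiden_widen.
Qed.

Lemma mcoeff_muni p j m : ((muni p)`_j)@_m = p@_(mnmwiden m + U_(z) *+ j).
Proof.
rewrite muniE coef_sum raddf_sum /=.
have e m' : (((p@_m' *: 'X_[mnmrestr m']) *: 'X^(m' z))`_j)@_m =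
    if m' == (mnmwiden m + U_(z) *+ j)%MM then p@_m' else 0.
  rewrite coefZ coefXn; case: eqP => [->|ne].
    rewrite mulr1 mcoeffZ mcoeffX.
    have [->|ne] := eqVneq m' (mnmwiden m + U_(z) *+ m' z)%MM.
      by rewrite mnmrestr_widen eqxx mulr1.
    case: eqP => [e|]; last by rewrite mulr0.
    by rewrite -e mnmrestrK eqxx in ne.
  rewrite mulr0 mcoeff0; case: eqP => // e.
  by rewrite e mnmwiden_max in ne.
rewrite (eq_bigr _ (fun m' _ => e m')); set m0 := (mnmwiden m + _)%MM.
have [h|h] := boolP (m0 \in msupp p).
  rewrite (bigD1_seq m0) ?msupp_uniq //= eqxx big1 ?addr0 // => i.
  by case: eqP.
rewrite big1_seq ?(memN_msupp_eq0 h) // => i /andP[_ hi].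
by case: eqP => // ei; rewrite ei (negbTE h) in hi.
Qed.

Lemma muni_inj p p' : muni p = muni p' -> p = p'.
Proof.
by move=> e; apply/mpolyP => m; rewrite -(mnmrestrK m) -!mcoeff_muni e.
Qed.

Lemma muni_mwiden q : muni (mwiden q) = q%:P.
Proof.
apply/polyP => j; apply/mpolyP => m; rewrite mcoeff_muni coefC.
case: (posnP j) => [->|j_gt0].
  by rewrite mulm0n addm0 mwiden_mnmwiden.
rewrite mcoeff0 (mwidenE (leqnn _)) raddf_sum big1 // => m' _ /=.
rewrite mcoeffZ mcoeffX; case: eqP => [e|]; last by rewrite mulr0.
by move: (mnmwiden_ordmax m') j_gt0; rewrite e mnmwiden_max => ->.
Qed.

Lemma muni_X : muni ('X_z : S) = 'X.
Proof.
rewrite muniE msuppX big_seq1 mcoeffX eqxx scale1r mnm1E eqxx expr1.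
rewrite (_ : [multinom _ | _ < n] = 0%MM) ?mpolyX0 ?scale1r //.
by apply/mnmP => i; rewrite !mnmE -val_eqE /= gtn_eqF ?ltn_ord.
Qed.

Lemma slices p N : (size (muni p) <= N)%N ->
  p = \sum_(j < N) 'X_z ^+ j * mwiden (muni p)`_j.
Proof.
move=> hN; apply: muni_inj; rewrite raddf_sum -{1}[muni p]coefK.
rewrite poly_def (big_ord_widen _ (fun j => (muni p)`_j *: 'X^j) hN).
rewrite [RHS](bigID (fun j : 'I_N => (j < size (muni p))%N)) /= [X in _ + X]big1 ?addr0.
  by apply: eq_bigr => j _; rewrite rmorphM rmorphXn /= muni_X muni_mwiden mulrC mul_polyC.
move=> j; rewrite -leqNgt => hj.
by rewrite nth_default // raddf0 mulr0 raddf0.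
Qed.

Local Notation widen_mx := (map_mx (@mwiden n k)).
Definition slice_mx j r s (A : 'M[S]_(r, s)) : 'M[R]_(r, s) :=
  map_mx (fun p => (muni p)`_j) A.

Lemma slice_mulmx j r s t (A : 'M[S]_(r, s)) (B : 'M[R]_(s, t)) :
  slice_mx j (A *m widen_mx B) = slice_mx j A *m B.
Proof.
apply/matrixP => a b; rewrite !mxE raddf_sum coef_sum; apply: eq_bigr => i _.
by rewrite /= !mxE muniM muni_mwiden coefMC.
Qed.

Lemma widen_mulmx r s t (A : 'M[R]_(r, s)) (B : 'M[R]_(s, t)) :
  widen_mx (A *m B) = widen_mx A *m widen_mx B.
Proof. exact: map_mxM. Qed.

Lemma slices_mx r s (A : 'M[S]_(r, s)) :
  exists N, A = \sum_(j < N) 'X_z ^+ j *: widen_mx (slice_mx j A).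
Proof.
pose N := (\max_(a < r) \max_(b < s) size (muni (A a b)))%N; exists N.
have hN a b : (size (muni (A a b)) <= N)%N.
  apply: leq_trans (leq_bigmax a).
  exact: (leq_bigmax (F := fun b => size (muni (A a b)))).
apply/matrixP => a b; rewrite summxE [LHS](slices (hN a b)).
by apply: eq_bigr => j _; rewrite !mxE.
Qed.

(** [S] is free over [R] on the powers of [z], and [muni] reads off coordinates. As [B] has entries
    in [R], the equation is solved one power of [z] at a time, and [slices_mx] reassembles finitely
    many solutions. *)
Lemma widen_factor r s t (A : 'M[S]_(r, t)) (B : 'M[R]_(s, t)) :
  (forall j, exists W, slice_mx j A = W *m B) -> exists W, A = W *m widen_mx B.
Proof.
move=> h; have [N {1}->] := slices_mx A.
have /fin_all_exists[W hW] (j : 'I_N) := h j.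
exists (\sum_(j < N) 'X_z ^+ j *: widen_mx (W j)); rewrite mulmx_suml.
by apply: eq_bigr => j _; rewrite hW widen_mulmx scalemxAl.
Qed.

Lemma slice_mx0 j r s : slice_mx j (0 : 'M[S]_(r, s)) = 0.
Proof. by apply/matrixP => a b; rewrite !mxE raddf0 coef0. Qed.

Lemma mideal_slices Q p :
  mideal (Q \o mnmrestr) p <-> forall j, mideal Q (muni p)`_j.
Proof.
split=> [/midealP h j|h]; apply/midealP => m.
  by rewrite mcoeff_muni => /h /=; rewrite mnmrestr_widen.
by rewrite -{1}(mnmrestrK m) -mcoeff_muni => hm; apply: (midealP _ _).1 hm.
Qed.

Definition widen_seq (F : free_seq k n) : free_seq k n.+1 := @FreeSeq k n.+1
  (frank F) (@fdeg _ _ F) (fun i => widen_mx (fdiff F i)) (widen_mx (faug F)).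

Lemma homog_widen d d' q : homog_entry d d' q -> homog_entry d d' (mwiden q).
Proof.
move=> /homog_entryP h; apply/homog_entryP => m.
rewrite -(mnmrestrK m) -mcoeff_muni muni_mwiden coefC.
case: (m z =P 0%N) => [->|_]; last by rewrite mcoeff0 eqxx.
by move/h; rewrite mulm0n addm0 mdeg_mnmwiden.
Qed.

(** This is flatness of [S] over [R]: exactness is checked on each slice. *)
Lemma widen_seq_resolves Q F : resolves (mideal Q) F ->
  resolves (mideal (Q \o mnmrestr)) (widen_seq F).
Proof.
move=> rF; split.
- by move=> i a b; rewrite mxE; apply/homog_widen/(rs_diff_graded rF i a b).
- by move=> a b; rewrite mxE; apply/homog_widen/(rs_aug_graded rF a b).
- move=> p; rewrite mideal_slices; split=> [h|[v ->] j].
    have [j|W hW] := @widen_factor _ _ _ (const_mx p : 'M[S]_1) (faug F).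
      have [v hv] := (rs_aug_im rF _).1 (h j).
      by exists v; apply/matrixP => x y; rewrite !ord1 !mxE hv mxE.
    by exists W; rewrite -hW mxE.
  by apply/(rs_aug_im rF); exists (slice_mx j v); rewrite -slice_mulmx [RHS]mxE.
- move=> v; split=> [h|[w ->]]; last first.
    by rewrite -mulmxA -widen_mulmx (rs_complex0 rF) map_mx0 mulmx0.
  apply: widen_factor => j; apply/(rs_exact0 rF).
  by rewrite -slice_mulmx [X in slice_mx _ X]h slice_mx0.
- move=> i v; split=> [h|[w ->]]; last first.
    by rewrite -mulmxA -widen_mulmx (rs_complexS _ rF) map_mx0 mulmx0.
  apply: widen_factor => j; apply/(rs_exactS rF).
  by rewrite -slice_mulmx [X in slice_mx _ X]h slice_mx0.
Qed.

Lemma widen_seq_minimal F : minimal_seq F -> minimal_seq (widen_seq F).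
Proof.
by move=> h i a b; rewrite mxE -(mnmwiden0 n) mwiden_mnmwiden; apply: h.
Qed.

End BaseChange.
Arguments mnmrestr {n} m.

(** * Finite resolutions of monomial ideals *)

Section MonomialResolutions.
Context (k : fieldType) (n : nat).
Local Notation R := {mpoly k[n]}.
Implicit Types (s : seq 'X_{1..n}) (g m : 'X_{1..n}).

Definition gen_by s : pred 'X_{1..n} := fun m => has (fun g => (g <= m)%MM) s.

Definition mnmlcm g g' : 'X_{1..n} := [multinom maxn (g i) (g' i) | i < n].

Lemma mnmlcm_le g g' m : (mnmlcm g g' <= m)%MM = (g <= m)%MM && (g' <= m)%MM.
Proof.
apply/mnm_lepP/andP => [h|[/mnm_lepP h /mnm_lepP h'] i].
  split; apply/mnm_lepP => i; apply: leq_trans (h i); rewrite mnmE.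
    exact: leq_maxl.
  exact: leq_maxr.
by rewrite mnmE geq_max h h'.
Qed.

Lemma principal_seq_resolves g :
  resolves (mideal (fun m => (g <= m)%MM)) (principal_seq k g).
Proof.
apply: principal_resolves => p.
rewrite (eq_mideal k (Q' := fun m => (g <= m)%MM && predT (m - g)%MM)); last first.
  by move=> m; rewrite andbT.
by rewrite midealMX; split=> [[q [_ ->]]|[q ->]]; exists q.
Qed.

Lemma zero_seq_resolves (Q : pred 'X_{1..n}) : Q =1 pred0 ->
  resolves (mideal Q) (zero_free_seq k n).
Proof.
move=> Q0; rewrite (_ : mideal Q = fun p : R => p = 0); first exact: resolves_zero.
apply: functional_extensionality => p; apply: propositional_extensionality.
split=> [/midealP h|->]; last exact: mideal0.
apply/mpolyP => m; rewrite mcoeff0; apply/eqP; apply: contraT => /h.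
by rewrite Q0.
Qed.

(** Adding a generator [g] is a mapping cone: the intersection of the old ideal with the ideal of
    [g] is generated by the least common multiples with [g]. Induction is on a bound for the number
    of generators, since these form a new list of the same length. *)
Lemma gen_by_resolution s : exists F : free_seq k n,
  resolves (mideal (gen_by s)) F /\ finite_seq F.
Proof.
have [N hs] : exists N, (size s <= N)%N by exists (size s).
elim: N s hs => [|N IH] [|g s] //= hs.
1,2: by exists (zero_free_seq k n); split; [exact: zero_seq_resolves|exists 0%N].
have [A [rA fA]] := IH s hs.
have [|C [rC fC]] := IH [seq mnmlcm h g | h <- s]; first by rewrite size_map.
have rB := principal_seq_resolves g.
have inter m : gen_by [seq mnmlcm h g | h <- s] m = gen_by s m && (g <= m)%MM.
  rewrite /gen_by has_map; elim: (s) => //= h s' ->.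
  by rewrite mnmlcm_le; case: (h <= m)%MM; case: (g <= m)%MM; rewrite /= ?andbF.
have CA p : mideal (gen_by [seq mnmlcm h g | h <- s]) p -> @mideal k n (gen_by s) p.
  by move=> h m /h; rewrite inter => /andP[].
have CB p : mideal (gen_by [seq mnmlcm h g | h <- s]) p ->
    @mideal k n (fun m => (g <= m)%MM) p.
  by move=> h m /h; rewrite inter => /andP[].
exists (cone (lift_maps C A) (lift_maps C (principal_seq k g))).
split; last first.
  by apply: cone_finite => //; exists 1%N => -[].
apply: (cone_resolves rA rB rC).
- exact: chain_map_exists rC rA CA.
- exact: chain_map_exists rC rB CB.
- by move=> p; rewrite (eq_mideal k inter) -midealI.
- move=> p; rewrite -midealU.
  rewrite (eq_mideal k (Q' := predU (gen_by s) (fun m => (g <= m)%MM))) // => m.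
  by rewrite /= orbC.
Qed.

End MonomialResolutions.

(** * Koszul resolutions and numerical invariants *)

Section Koszul.
Context (k : fieldType) (n : nat).
Local Notation R := {mpoly k[n]}.
Implicit Types (F A C : free_seq k n).

(** Multiplication by ['X_[m]] covers the inclusion of the multiple of an ideal into the ideal
    itself, giving an explicit lift with known entries. *)
Lemma scalar_chain_map (m : 'X_{1..n}) F :
  @chain_map k n (shift_seq m F) F (fun i => ('X_[m])%:M).
Proof.
split=> [i a b||i].
- rewrite mxE; case: eqP => [->|_]; last exact: homog_entry0.
  by rewrite mulr1n /= addnC; exact: homog_entryX.
- by apply/matrixP => a b; rewrite mul_scalar_mx !mxE mulrC.
- by rewrite -scalar_mxC.
Qed.

Definition entries_in (P : R -> Prop) r s (A : 'M[R]_(r, s)) := forall a b, P (A a b).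

Lemma entries_in_row P r s t (A : 'M_(r, s)) (B : 'M_(r, t)) :
  entries_in P A -> entries_in P B -> entries_in P (row_mx A B).
Proof. by move=> hA hB a b; rewrite mxE; case: (split b) => c; [apply: hA|apply: hB]. Qed.

Lemma entries_in_col P r s t (A : 'M_(r, t)) (B : 'M_(s, t)) :
  entries_in P A -> entries_in P B -> entries_in P (col_mx A B).
Proof. by move=> hA hB a b; rewrite mxE; case: (split a) => c; [apply: hA|apply: hB]. Qed.

Lemma entries_in_block P r1 r2 s1 s2 (A : 'M_(r1, s1)) (B : 'M_(r1, s2))
    (C : 'M_(r2, s1)) (D : 'M_(r2, s2)) :
  entries_in P A -> entries_in P B -> entries_in P C -> entries_in P D ->
  entries_in P (block_mx A B C D).
Proof. by move=> *; apply: entries_in_col; apply: entries_in_row. Qed.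

Definition vars_ideal (s : seq 'I_n) : pred 'X_{1..n} :=
  fun m => has (fun x => (0 < m x)%N) s.

Lemma vars_ideal_sub s s' (p : R) : {subset s <= s'} ->
  mideal (vars_ideal s) p -> mideal (vars_ideal s') p.
Proof. by move=> ss h m /h /hasP[x /ss xs mx]; apply/hasP; exists x. Qed.

Lemma lep1m x (m : 'X_{1..n}) : (U_(x) <= m)%MM = (0 < m x)%N.
Proof. by rewrite lep1mP lt0n. Qed.

(** Induction by mapping cones: the ideal of [s] meets that of [x] in its multiple by [x], resolved
    by a shift of [A]. This also keeps the resolution linear and its entries in the ideal of the
    variables. *)
Lemma koszul_resolution (s : seq 'I_n) : uniq s -> exists K : free_seq k n,
  [/\ resolves (mideal (vars_ideal s)) K, finite_seq K,
      forall i d, has_degree K i d -> d = i.+1 &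
      forall i, entries_in (mideal (vars_ideal s)) (fdiff (quot_seq K) i)].
Proof.
elim: s => [_|x s IH] /=.
  exists (zero_free_seq k n); split.
  - exact: zero_seq_resolves.
  - by exists 0%N.
  - by move=> i d [] [].
  - by case=> [|i] [].
case/andP => xs /IH[A [rA fA dA eA]] {IH}.
pose xm := U_(x)%MM : 'X_{1..n}; pose B := principal_seq k xm; pose C := shift_seq xm A.
have rB : resolves (mideal (fun m => (xm <= m)%MM)) B := principal_seq_resolves k xm.
have inter m : (xm <= m)%MM && vars_ideal s (m - xm)%MM =
    vars_ideal s m && (xm <= m)%MM.
  rewrite andbC; congr andb; apply: eq_in_has => y ys.
  rewrite mnmBE mnm1E; case: eqP => [e|]; last by rewrite subn0.
  by rewrite e ys in xs.
have rC : resolves (mideal (predI (vars_ideal s) (fun m => (xm <= m)%MM))) C.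
  rewrite -(eq_mideal k inter); apply: (shift_seq_resolves rA) => p.
  exact: midealMX.
have cB : chain_map (lift_maps C B).
  by apply: (chain_map_exists rC rB) => p /midealI[].
have sub : {subset s <= x :: s} by move=> y ys; rewrite inE ys orbT.
have Px : mideal (vars_ideal (x :: s)) ('X_[xm] : R).
  by apply/midealX; rewrite /= mnm1E eqxx.
have Ps (p : R) : mideal (vars_ideal s) p -> mideal (vars_ideal (x :: s)) p.
  exact: vars_ideal_sub sub.
(* Both augmentations carry the factor [x]; cancelling it identifies the lift. *)
have aB : lift_maps C B 0 = faug A.
  have := cm_aug cB; move/matrixP => e; apply/matrixP => a b; move: (e a b).
  rewrite !mxE big_ord1 !mxE !ord1 => e0.
  exact: (mulIf (mpolyX_neq0 k xm) e0).
exists (cone (fun i => ('X_[xm])%:M : 'M_(frank C i, frank A i)) (lift_maps C B)); split.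
- apply: (cone_resolves rA rB rC (scalar_chain_map _ _) cB) => p; first exact: midealI.
  rewrite -midealU.
  rewrite (eq_mideal k (Q' := predU (vars_ideal s) (fun m => (xm <= m)%MM))) //.
  by move=> m /=; rewrite lep1m orbC.
- by apply: cone_finite => //; exists 1%N => -[].
- move=> i d /cone_has_degree[/dA //|[a <-]|[i' -> [a <-]]].
    by case: i a => [|i] [] //=; rewrite mdeg1.
  by rewrite /= mdeg1 addn1; congr _.+1; apply: dA; exists a.
have e0 r t : entries_in (mideal (vars_ideal (x :: s))) (0 : 'M[R]_(r, t)).
  by move=> a b; rewrite mxE; exact: mideal0.
case=> [|i] /=.
  apply: entries_in_col => //; apply: entries_in_col.
    by move=> a b; apply: Ps; apply: (eA 0%N).
  by move=> a b; rewrite mxE.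
apply: entries_in_block => //.
- apply: entries_in_block => //.
  by move=> a b; apply: Ps; apply: (eA i.+1).
- apply: entries_in_row => a b; rewrite mxE.
    by case: eqP => _; rewrite ?mulr1n // mulr0n; exact: mideal0.
  (* [B] is concentrated in position 0, so only the lift identified by [aB] has entries. *)
  case: i a b => [|i] a; last by case.
  rewrite aB => b; apply/midealN/Ps; apply: (eA 0%N).
- case: i => [|i] a b; first by case: b.
  by rewrite mxE; apply/midealN/Ps; apply: (eA i.+1).
Qed.

Lemma linear_minimal I (K : free_seq k n) : resolves I K ->
  (forall i d, has_degree K i d -> d = i.+1) -> minimal_seq K.
Proof.
move=> rK lin i a b; apply: (homog_entry_const0 (rs_diff_graded rK i a b)).
rewrite (lin i.+1 (fdeg a)); last by exists a.
by rewrite (lin i (fdeg b)); [move/eqP; rewrite eqn_leq ltnn|exists b].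
Qed.

End Koszul.

(** * Degrees in minimal resolutions and the numerical invariants *)

Section Invariants.
Context (k : fieldType) (n : nat).
Local Notation R := {mpoly k[n]}.
Implicit Types (F : free_seq k n) (Q : pred 'X_{1..n}).

Lemma mideal_const0 Q (p : R) : ~~ Q 0%MM -> mideal Q p -> p@_0%MM = 0.
Proof.
by move=> Q0 /midealP h; apply/eqP; apply: contraT => /h; rewrite (negbTE Q0).
Qed.

(** Degrees strictly increase along a minimal resolution: every row of a differential has a nonzero
    entry, and this entry has no constant term, hence positive degree. The generators of the ideal
    start at degree 2. *)
Lemma minimal_degrees Q F : ~~ Q 0%MM -> (forall m, Q m -> (2 <= mdeg m)%N) ->
  resolves (mideal Q) F -> minimal_seq F ->
  forall i d, has_degree F i d -> (i.+2 <= d)%N.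
Proof.
move=> Q0 Q2 rF minF.
(* A basis vector is not in the image of a map whose entries lack constant terms, so by exactness it
   is not in the next kernel either. *)
have nz m r s (A : 'M[R]_(m, r)) (B : 'M[R]_(s, m)) a :
    (forall x y, (B x y)@_0%MM = 0) ->
    (forall v : 'rV_m, v *m A = 0 -> exists w, v = w *m B) -> exists b, A a b != 0.
  move=> B0 exact; apply: NNPP => h.
  have [|w ew] := exact (delta_mx 0 a).
    rewrite -rowE; apply/rowP => b; rewrite mxE mxE; apply/eqP.
    by apply: contra_notT h => ?; exists b.
  have := @mulmx_const0 k n _ _ _ w B 0 a (or_intror B0).
  by rewrite -ew mxE !eqxx mcoeff1 eqxx => /eqP; rewrite oner_eq0.
have supp (p : R) : p != 0 -> exists2 m, m \in msupp p & p@_m != 0.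
  rewrite -msupp_eq0; case e: (msupp p) => [//|m l] _.
  have hm : m \in msupp p by rewrite e inE eqxx.
  by exists m; [rewrite inE eqxx|rewrite -mcoeff_msupp].
elim=> [|i IH] d [a <-].
  have [b] := nz _ _ _ (faug F) (fdiff F 0) a (minF 0%N) (fun v => (rs_exact0 rF v).1).
  rewrite ord1 => /supp[m hm _]; rewrite -(rs_aug_graded rF a 0 m hm) addn0.
  exact/Q2/(rs_aug_mem rF a).
have [b] := nz _ _ _ (fdiff F i) (fdiff F i.+1) a (minF i.+1) (fun v => (rs_exactS rF v).1).
move=> /supp[m hm mne]; rewrite -(rs_diff_graded rF i a b m hm) -add1n leq_add //.
  rewrite lt0n mdeg_eq0; apply: contraNneq mne => ->; apply/eqP.
  exact: minF.
by apply: IH; exists b.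
Qed.

(** [betti] uses an arbitrarily chosen minimal resolution; [degree_transfer] in both directions lets
    any other one be used. *)
Lemma betti_neq0 Q F i j : upclosed Q -> minimal_graded_free_resolution (mideal Q) F ->
  betti (@mideal k n Q) i j <> 0%N <-> has_degree F i j.
Proof.
move=> upQ resF.
have resM : minimal_graded_free_resolution (mideal Q) (min_resolution (@mideal k n Q)).
  by apply: epsilon_spec; exists F.
rewrite /betti; split=> [h|].
  apply: (degree_transfer upQ resM resF); apply: NNPP => nh; apply: h.
  apply: eq_card0 => a; rewrite inE; apply/eqP => ea.
  by apply: nh; exists a.
move=> /(degree_transfer upQ resF resM)[a ea] /eqP.
by rewrite cards_eq0 => /eqP/setP/(_ a); rewrite !inE ea eqxx.
Qed.

Lemma pdim_quotient_eq (I : R -> Prop) p : is_pdim_quotient I p -> pdim_quotient I = p.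
Proof.
move=> hp; have : is_pdim_quotient I (pdim_quotient I).
  by apply: epsilon_spec; exists p.
case: hp => [[j hj] hp] [[j' hj'] hp'].
by apply/eqP; rewrite eqn_leq (hp _ _ hj') (hp' _ _ hj).
Qed.

Lemma reg_quotient_eq (I : R -> Prop) r : is_reg_quotient I r -> reg_quotient I = r.
Proof.
move=> hr; have : is_reg_quotient I (reg_quotient I).
  by apply: epsilon_spec; exists r.
case: hr => [[i [j [hj ->]]] hr] [[i' [j' [hj' er']]] hr'].
apply/eqP; rewrite Order.POrderTheory.eq_le hr' // andbT er'; exact: hr.
Qed.

Lemma has_degree_quot F i d : has_degree (quot_seq F) i d <->
  (if i is i'.+1 then has_degree F i' d else d = 0%N).
Proof.
case: i => [|i]; split => //; first by case=> a <-.
by move=> ->; exists 0.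
Qed.

Lemma bounded_max (P : nat -> Prop) N : (exists x, P x) ->
  (forall x, P x -> (x <= N)%N) -> exists2 m, P m & forall x, P x -> (x <= m)%N.
Proof.
elim: N => [|N IH] [x Px] hN.
  by exists x => // y /hN; rewrite leqn0 => /eqP ->.
have [PN|nP] := excluded_middle_informative (P N.+1); first by exists N.+1.
apply: IH; first by exists x.
move=> y Py; move: (hN y Py); rewrite leq_eqVlt => /orP[/eqP ey|//].
by rewrite ey in Py.
Qed.

Lemma finite_seq_bound F : finite_seq F ->
  exists N, forall i d, has_degree F i d -> (i <= N)%N /\ (d <= N)%N.
Proof.
move=> [N hN]; pose D i := (\max_(a < frank F i) fdeg a)%N.
exists (maxn N (\max_(i < N) D i)) => i d [a <-].
have iN : (i < N)%N.
  by rewrite ltnNge; apply/negP => /hN F0; move: (ltn_ord a); rewrite [X in (_ < X)%N]F0.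
split; first by rewrite leq_max ltnW.
rewrite leq_max; apply/orP; right.
apply: leq_trans (leq_bigmax (F := fun i : 'I_N => D i) (Ordinal iN)).
exact: (leq_bigmax (F := fun a => fdeg a)).
Qed.

End Invariants.

(** * Edge ideals and suspensions *)

Section EdgeIdeals.
Context (k : fieldType).

Definition edge_mon n (e : rel 'I_n) : pred 'X_{1..n} :=
  fun m => [exists u, exists v, [&& e u v, (0 < m u)%N & (0 < m v)%N]].

Lemma edge_monP n (e : rel 'I_n) (m : 'X_{1..n}) :
  reflect (exists u v, [/\ e u v, (0 < m u)%N & (0 < m v)%N]) (edge_mon e m).
Proof.
apply: (iffP existsP) => [[u /existsP[v /and3P h]]|[u [v /and3P h]]]; exists u.
  by exists v.
by apply/existsP; exists v.
Qed.

Lemma edge_mon_upclosed n (e : rel 'I_n) : upclosed (edge_mon e).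
Proof.
move=> m m' /edge_monP[u [v [uv mu mv]]]; apply/edge_monP; exists u, v.
by rewrite !mnmDE !ltn_addr.
Qed.

Lemma edge_mon_le n (e : rel 'I_n) u v (m : 'X_{1..n}) : irreflexive e -> e u v ->
  (U_(u) + U_(v) <= m)%MM = (0 < m u)%N && (0 < m v)%N.
Proof.
move=> irr uv; have ne : u != v by apply: contraTneq uv => ->; rewrite irr.
apply/mnm_lepP/andP => [h|[mu mv] i].
  move: (h u) (h v); rewrite !mnmDE !mnm1E !eqxx (negbTE ne) eq_sym (negbTE ne).
  by rewrite addn0 add0n.
rewrite mnmDE !mnm1E; have [<-|] := eqVneq u i.
  by rewrite eq_sym (negbTE ne) addn0.
by have [<-|] := eqVneq v i.
Qed.

Lemma edge_mon0 n (e : rel 'I_n) : ~~ edge_mon e 0%MM.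
Proof. by apply/edge_monP => -[u [v []]]; rewrite mnm0E. Qed.

Lemma edge_mon_mdeg n (e : rel 'I_n) (m : 'X_{1..n}) : irreflexive e ->
  edge_mon e m -> (2 <= mdeg m)%N.
Proof.
move=> irr /edge_monP[u [v [uv mu mv]]].
have := edge_mon_le m irr uv; rewrite mu mv => /submK <-.
by rewrite !mdegD !mdeg1 addnC leq_addr.
Qed.

Lemma edge_idealE n (e : rel 'I_n) : irreflexive e ->
  edge_ideal k e = mideal (edge_mon e).
Proof.
move=> irr; apply: functional_extensionality => p; apply: propositional_extensionality.
split=> [[c ->]|hp].
  apply: mideal_sum => u _; apply: mideal_sum => v uv.
  apply: (midealMl (@edge_mon_upclosed n e)); rewrite -mpolyXD; apply/midealX/edge_monP.
  by exists u, v; rewrite !mnmDE !mnm1E !eqxx addnC; split; rewrite // addnC.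
rewrite (mpolyE p) big_seq; apply: big_ind.
- exists (fun _ _ => 0); rewrite big1 // => u _; rewrite big1 // => v _.
  by rewrite mul0r.
- move=> _ _ [c ->] [c' ->]; exists (fun u v => c u v + c' u v).
  rewrite -big_split; apply: eq_bigr => u _; rewrite -big_split; apply: eq_bigr => v _.
  by rewrite mulrDl.
- move=> m /hp /edge_monP[u [v [uv mu mv]]].
  (* One edge dividing the monomial suffices: the coefficients are concentrated on that pair. *)
  exists (fun u' v' =>
    if (u' == u) && (v' == v) then p@_m *: 'X_[m - (U_(u) + U_(v))] else 0).
  rewrite (bigD1 u) //= [X in _ + X]big1 ?addr0; last first.
    by move=> u' ne; rewrite big1 // => v' _; rewrite (negbTE ne) mul0r.
  rewrite (bigD1 v) //= [X in _ + X]big1 ?addr0; last first.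
    by move=> v' /andP[_ ne]; rewrite (negbTE ne) andbF mul0r.
  rewrite !eqxx /= -scalerAl -!mpolyXD submK //.
  by rewrite (edge_mon_le _ irr uv) mu mv.
Qed.

Lemma edge_ideal_resolution n (e : rel 'I_n) : irreflexive e ->
  exists F : free_seq k n,
    [/\ resolves (mideal (edge_mon e)) F, minimal_seq F & finite_seq F].
Proof.
move=> irr.
(* An edge may be listed in both orientations; repeated generators are harmless, as the resolution
   is minimized afterwards. *)
pose s := [seq (U_(uv.1) + U_(uv.2))%MM | uv <- enum [pred uv : 'I_n * 'I_n | e uv.1 uv.2]].
have -> : mideal (edge_mon e) = @mideal k n (gen_by s).
  apply: eq_mideal => m; apply/edge_monP/hasP => [[u [v [uv mu mv]]]|].
    exists (U_(u) + U_(v))%MM; last by rewrite (edge_mon_le _ irr uv) mu mv.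
    by apply/mapP; exists (u, v); rewrite ?mem_enum.
  move=> [g /mapP[[u v]]]; rewrite mem_enum inE /= => uv ->.
  by rewrite (edge_mon_le _ irr uv) => /andP[mu mv]; exists u, v.
have [F [rF [N hN]]] := gen_by_resolution k s.
exists (min_seq N (mideal (gen_by s))); apply: min_seqP; first exact: mideal0.
exact: (resolves_resolvable rF hN).
Qed.

End EdgeIdeals.

(** * The mapping cone resolving the edge ideal of the suspension *)

Section Suspension.
Context (k : fieldType) (n : nat) (e : rel 'I_n) (C : {set 'I_n}).
Hypothesis e_irr : irreflexive e.
Hypothesis C_cover : vertex_cover e C.
Local Notation S := {mpoly k[n.+1]}.
Local Notation z := (@ord_max n).
Local Notation PC := (vars_ideal (enum C)).
Local Notation zm := (U_(z)%MM : 'X_{1..n.+1}).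

Lemma suspension_irr : irreflexive (suspension e C).
Proof. by move=> u; rewrite /suspension; case: (unlift _ u). Qed.

Lemma edge_mon_cover m : edge_mon e m -> PC m.
Proof.
case/edge_monP => u [v [uv mu mv]]; apply/hasP.
move: C_cover => /forallP/(_ u)/forallP/(_ v)/implyP/(_ uv) /orP[uC|vC].
  by exists u; rewrite ?mem_enum.
by exists v; rewrite ?mem_enum.
Qed.

Lemma lift_widen (i : 'I_n) : lift z i = widen_ord (leqnSn n) i.
Proof. by apply: val_inj; exact: lift_max. Qed.

Lemma suspension_mon (m : 'X_{1..n.+1}) : edge_mon (suspension e C) m =
  edge_mon e (mnmrestr m) || ((zm <= m)%MM && PC (mnmrestr (m - zm)%MM)).
Proof.
have mE i : mnmrestr m i = m (lift z i) by rewrite mnmE lift_widen.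
rewrite mnmrestrB lep1m; apply/edge_monP/orP => [[u [v []]]|].
  rewrite /suspension.
  case: (unliftP z u) => [i ->|->]; case: (unliftP z v) => [j ->|->] //.
  - by move=> ij mi mj; left; apply/edge_monP; exists i, j; rewrite !mE.
  - move=> iC mi mz; right; rewrite mz; apply/hasP; exists i; first by rewrite mem_enum.
    by rewrite mE.
  - move=> jC mz mj; right; rewrite mz; apply/hasP; exists j; first by rewrite mem_enum.
    by rewrite mE.
case=> [/edge_monP[i [j [ij]]]|/andP[mz /hasP[i]]].
  by rewrite !mE => mi mj; exists (lift z i), (lift z j); rewrite /suspension !liftK.
rewrite mem_enum mE => iC mi; exists z, (lift z i).
by rewrite /suspension unlift_none liftK.
Qed.

Context (F K : free_seq k n).
Hypothesis rF : resolves (mideal (edge_mon e)) F.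
Hypothesis rK : resolves (mideal PC) K.
Hypothesis linK : forall i d, has_degree K i d -> d = i.+1.
Hypotheses (minF : minimal_seq F) (F_deg : forall i d, has_degree F i d -> (i.+2 <= d)%N).

Let FS := widen_seq F.
Let KS := shift_seq zm (widen_seq K).
Let ZS := shift_seq zm FS.

(** [FS], [KS] and [ZS] resolve the extension of [I] to [S], [zP], and their intersection [zI];
    multiplication by [z] covers the inclusion of [zI] in the extended [I]. *)
Definition suspension_seq : free_seq k n.+1 :=
  @cone k n.+1 FS KS ZS (fun i => ('X_[zm])%:M) (lift_maps ZS KS).

Lemma suspension_seqP : resolves (mideal (edge_mon (suspension e C))) suspension_seq
  /\ minimal_seq suspension_seq.
Proof.
have rFS : resolves _ FS := widen_seq_resolves rF.
have rKS : resolves (mideal (fun m => (zm <= m)%MM && (PC \o mnmrestr) (m - zm)%MM)) KS.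
  by apply: (shift_seq_resolves (widen_seq_resolves rK)) => p; exact: midealMX.
have rZS : resolves (mideal (predI (edge_mon e \o mnmrestr)
    (fun m => (zm <= m)%MM && (PC \o mnmrestr) (m - zm)%MM))) ZS.
  rewrite (eq_mideal k
    (Q' := fun m => (zm <= m)%MM && (edge_mon e \o mnmrestr) (m - zm)%MM)).
    by apply: (shift_seq_resolves rFS) => p; exact: midealMX.
  (* Forgetting [z] does not see division by [z], and [I <= P] absorbs the condition from [P]: the
     intersection is [zI]. *)
  move=> m /=; rewrite mnmrestrB andbCA; congr andb.
  by case: (boolP (edge_mon e _)) => // /edge_mon_cover ->.
have cg : chain_map (lift_maps ZS KS).
  by apply: (chain_map_exists rZS rKS) => p /midealI[].
split.
  apply: (cone_resolves rFS rKS rZS (scalar_chain_map _ _) cg) => p; first exact: midealI.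
  by rewrite (eq_mideal k suspension_mon) -midealU.
have minFS : minimal_seq FS := widen_seq_minimal minF.
have minKS : minimal_seq KS by exact: (widen_seq_minimal (linear_minimal rK linK)).
have X0 : ('X_[zm] : S)@_0%MM = 0.
  by rewrite mcoeffX; case: eqP => // /(congr1 (@mdeg _)); rewrite mdeg1 mdeg0.
pose P (p : S) := p@_0%MM = 0.
have P0 r s : entries_in P (0 : 'M[S]_(r, s)) by move=> a b; rewrite /P mxE mcoeff0.
move=> i; suff : entries_in P (fdiff suspension_seq i) by [].
apply: entries_in_block => //.
- by apply: entries_in_block => //; [exact: minFS|exact: minKS].
- apply: entries_in_row => a b; rewrite /P mxE.
    by case: eqP => _; rewrite ?mulr1n ?mulr0n ?mcoeff0.
  rewrite mcoeffN; apply/eqP; rewrite oppr_eq0; apply/eqP.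
  (* After the shift by [z], the source generator has degree at least [i + 3] and the target one
     degree [i + 2], so the entry cannot be a unit. *)
  apply: (homog_entry_const0 (cm_graded cg i a b)) => /=; apply/eqP.
  rewrite mdeg1 !addn1 eqSS gtn_eqF //.
  change (fdeg (f := K) b < fdeg (f := F) a)%N.
  rewrite (linK (i := i) (d := fdeg (f := K) b)); last by exists b.
  by apply: (F_deg (i := i)); exists a.
- case: i => [|i] a b; first by case: b.
  rewrite /P mxE mcoeffN; apply/eqP; rewrite oppr_eq0; apply/eqP; exact: minFS.
Qed.

Lemma suspension_degrees i d : has_degree suspension_seq i d <->
  [\/ has_degree F i d, exists2 d', d = d'.+1 & has_degree K i d' |
      exists i' d', [/\ i = i'.+1, d = d'.+1 & has_degree F i' d']].
Proof.
rewrite cone_has_degree; split=> -[].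
- by move=> h; constructor 1.
- move=> [a <-]; constructor 2; exists (fdeg (f := K) a); last by exists a.
  by rewrite /= mdeg1 addn1.
- move=> [i' -> [a <-]]; constructor 3; exists i', (fdeg (f := F) a); split=> //.
    by rewrite /= mdeg1 addn1.
  by exists a.
- by move=> h; constructor 1.
- move=> [d' -> [a <-]]; constructor 2; exists a; by rewrite /= mdeg1 addn1.
- move=> [i' [d' [-> -> [a <-]]]]; constructor 3; exists i' => //; exists a.
  by rewrite /= mdeg1 addn1.
Qed.

End Suspension.

(** [pdim_lower_bound] is applied to the product [g] of the variables outside [C], which multiplies
    the ideal of the cover into the edge ideal without lying in the latter. *)
Lemma cover_length (k : fieldType) n (e : rel 'I_n) (C : {set 'I_n})
    (F K : free_seq k n) c :
  ssrbool.symmetric e -> irreflexive e -> minset (vertex_cover e) C ->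
  resolves (mideal (edge_mon e)) F -> resolves (mideal (vars_ideal (enum C))) K ->
  (forall i, entries_in (mideal (vars_ideal (enum C))) (fdiff (quot_seq K) i)) ->
  frank K c <> 0%N -> frank K c.+1 = 0%N -> frank F c <> 0%N.
Proof.
move=> e_sym e_irr C_min rF rK eK; have [C_cover C_least] := minsetP C_min.
pose g : 'X_{1..n} := [multinom (i \notin C : nat) | i < n].
apply: (pdim_lower_bound (g := 'X_[g]) rF rK) => [a b|].
  move=> m; rewrite (perm_mem (msuppMX _ _)) => /mapP[m1 /(eK c a b) /hasP[x]].
  rewrite mem_enum => xC mx ->.
  (* If every neighbour of [x] were in [C], then [C :\ x] would still be a cover. A neighbour [v]
     outside [C] makes [x] times [g] divisible by the edge [xv]. *)
  have [v xv vC] : exists2 v, e x v & v \notin C.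
    apply: NNPP => nv; have : C :\ x = C.
      apply: C_least; last exact: subD1set.
      apply/forallP => u; apply/forallP => v; apply/implyP => uv; rewrite !inE.
      have uCv : (u \in C) || (v \in C).
        by move/forallP: C_cover => /(_ u)/forallP/(_ v)/implyP/(_ uv).
      have [ux|ux] := eqVneq u x; have [vx|vx] := eqVneq v x => //=.
      + by rewrite ux vx e_irr in uv.
      + apply/negPn/negP => vC; apply: nv; exists v => //; by rewrite -ux.
      + rewrite orbF; apply/negPn/negP => uC; apply: nv; exists u => //.
        by rewrite e_sym -vx.
    by move/setP => /(_ x); rewrite !inE eqxx xC.
  apply/edge_monP; exists x, v; split=> //; rewrite mnmDE.
    by rewrite ltn_addl.
  by rewrite ltn_addr // mnmE vC.
(* An edge dividing [g] would have both ends outside the cover. *)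
move/midealX/edge_monP => [u [v [uv]]]; rewrite !mnmE => uC vC.
move/forallP: C_cover => /(_ u)/forallP/(_ v)/implyP/(_ uv).
by case: (u \in C) uC; case: (v \in C) vC.
Qed.

Lemma resolves_nonzero (k : fieldType) n (Q : pred 'X_{1..n}) (F : free_seq k n) m :
  resolves (mideal Q) F -> Q m -> frank F 0 <> 0%N.
Proof.
move=> rF Qm F0.
have /(rs_aug_im rF)[v] : mideal Q ('X_[m] : {mpoly k[n]}) by apply/midealX.
rewrite mxE big1 => [/eqP|j _]; first by rewrite (negbTE (mpolyX_neq0 k m)).
by move: (ltn_ord j); rewrite [X in (_ < X)%N]F0.
Qed.

Lemma has_degree_rank (k : fieldType) n (F : free_seq k n) i :
  frank F i <> 0%N <-> exists d, has_degree F i d.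
Proof.
split=> [|[d [a _]] F0]; last by move: (ltn_ord a); rewrite [X in (_ < X)%N]F0.
move/eqP; rewrite -lt0n => F0.
by exists (fdeg (f := F) (Ordinal F0)), (Ordinal F0).
Qed.

Theorem theorem3p5 (k : fieldType) (n : nat) (n_gt0 : (0 < n)%N)
    (e : rel 'I_n) (e_sym : ssrbool.symmetric e) (e_irr : irreflexive e)
    (e_noiso : no_isolated e)
    (C : {set 'I_n}) (C_min : minset (vertex_cover e) C) :
  reg_quotient (edge_ideal k (suspension e C)) = reg_quotient (edge_ideal k e)
  /\
  pdim_quotient (edge_ideal k (suspension e C))
    = (pdim_quotient (edge_ideal k e) + 1)%N.
Proof.
have [C_cover _] := minsetP C_min.
have [F [rF minF finF]] := edge_ideal_resolution k e_irr.
have [K [rK finK linK eK]] := koszul_resolution k (enum_uniq C).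
have degF := minimal_degrees (edge_mon0 e) (fun m => @edge_mon_mdeg _ e m e_irr) rF minF.
have [rG minG] := suspension_seqP C_cover rF rK linK minF degF.
have degG := suspension_degrees F K.
set G := suspension_seq F K in rG minG degG.
rewrite !edge_idealE //; last exact: suspension_irr.
have min_aug l (e' : rel 'I_l) (E : free_seq k l) : resolves (mideal (edge_mon e')) E ->
    forall a, (faug E a 0)@_0%MM = 0.
  by move=> rE a; apply: (mideal_const0 (edge_mon0 e')); exact: rs_aug_mem rE a.
have bF i j := betti_neq0 i j (@edge_mon_upclosed _ e)
  (quot_seq_resolution rF minF (min_aug _ _ _ rF)).
have bG i j := betti_neq0 i j (@edge_mon_upclosed _ (suspension e C))
  (quot_seq_resolution rG minG (min_aug _ _ _ rG)).
(* Some edge exists, so neither the edge ideal nor the ideal of the cover is zero and the maxima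
   below are over nonempty sets. *)
have [v uv] := e_noiso (Ordinal n_gt0); set u := Ordinal n_gt0 in uv.
have Qm : edge_mon e (U_(u) + U_(v))%MM.
  have := edge_mon_le (U_(u) + U_(v))%MM e_irr uv.
  by rewrite lepm_refl => /esym/andP[? ?]; apply/edge_monP; exists u, v.
have [d0 F0] := (has_degree_rank F 0).1 (resolves_nonzero rF Qm).
have [d1 K0] := (has_degree_rank K 0).1 (resolves_nonzero rK (edge_mon_cover C_cover Qm)).
have [NF bdF] := finite_seq_bound finF; have [NK bdK] := finite_seq_bound finK.
(* [p] is the last position of [F] as a resolution of the ideal, so the quotient has projective
   dimension [p + 1]. *)
have [p [dp Fp] p_max] : exists2 p, (exists d, has_degree F p d) &
    forall i, (exists d, has_degree F i d) -> (i <= p)%N.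
  apply: (bounded_max (N := NF)); first by exists 0%N, d0.
  by move=> i [d /bdF[]].
have [c [dc Kc] c_max] : exists2 c, (exists d, has_degree K c d) &
    forall i, (exists d, has_degree K i d) -> (i <= c)%N.
  apply: (bounded_max (N := NK)); first by exists 0%N, d1.
  by move=> i [d /bdK[]].
have c_le_p : (c <= p)%N.
  apply/p_max/has_degree_rank/(cover_length e_sym e_irr C_min rF rK eK).
    by apply/has_degree_rank; exists dc.
  by apply: NNPP => /has_degree_rank/c_max; rewrite ltnn.
(* The offset [i + 1] is the homological degree of [F_i] in the resolution of the quotient; [degF]
   keeps the difference a natural number. *)
have [r [ir [dr [Fr er]]] r_max] : exists2 r,
    (exists i d, has_degree F i d /\ d = (i.+1 + r)%N) &
    forall r', (exists i d, has_degree F i d /\ d = (i.+1 + r')%N) -> (r' <= r)%N.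
  apply: (bounded_max (N := NF)).
    exists (d0 - 1)%N, 0%N, d0; split=> //; rewrite subnKC //.
    by apply: leq_trans (degF _ _ F0).
  move=> r [i [d [/bdF[_ dN] ed]]]; apply: leq_trans dN; rewrite ed; exact: leq_addl.
have r_bound i d : has_degree F i d -> d%:Z - i.+1%:Z <= r%:Z.
  move=> Fd; have := degF _ _ Fd => /ltnW h.
  rewrite subzn // lez_nat; apply: r_max; exists i, d; split=> //.
  by rewrite subnKC.
(* The generators of [zP] contribute exactly 1 to the regularity, and this bound absorbs them. *)
have r_gt0 : (1 <= r)%N.
  apply: leq_trans (r_max (d0 - 1)%N _).
    by rewrite subn_gt0; exact: degF F0.
  by exists 0%N, d0; split=> //; rewrite subnKC // ltnW // (degF _ _ F0).
have pdF : is_pdim_quotient (@mideal k n (edge_mon e)) p.+1.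
  split=> [|i j /bF/has_degree_quot].
    by exists dp; apply/bF/has_degree_quot.
  by case: i => [//|i] Fi; rewrite ltnS p_max //; exists j.
have pdG : is_pdim_quotient (@mideal k n.+1 (edge_mon (suspension e C))) p.+2.
  split=> [|i j /bG/has_degree_quot].
    (* The copy of [F_p] coming from [zI] sits one step higher and realizes the new length. *)
    exists dp.+1; apply/bG/has_degree_quot/degG; constructor 3.
    by exists p, dp.
  case: i => [//|i] /degG[h|[d' _ h]|[i' [d' [-> _ h]]]]; rewrite ltnS.
  - by apply/leqW/p_max; exists j.
  - by apply/leqW/(leq_trans _ c_le_p)/c_max; exists d'.
  - by rewrite ltnS; apply: p_max; exists d'.
have regE : r%:Z = dr%:Z - ir.+1%:Z by rewrite er PoszD addrC addKr.
have rgF : is_reg_quotient (@mideal k n (edge_mon e)) r%:Z.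
  split=> [|i j /bF/has_degree_quot].
    by exists ir.+1, dr; split=> //; apply/bF/has_degree_quot.
  by case: i => [->|i /r_bound //].
have rgG : is_reg_quotient (@mideal k n.+1 (edge_mon (suspension e C))) r%:Z.
  split=> [|i j /bG/has_degree_quot].
    exists ir.+1, dr; split=> //; apply/bG/has_degree_quot/degG.
    by constructor 1.
  case: i => [->//|i] /degG[/r_bound //|[d' -> /linK ->]|[i' [d' [-> -> /r_bound h]]]].
    by rewrite subzn // lez_nat subSnn.
  (* For [zI] both the degree and the homological degree grow by one, so their difference is
     unchanged. *)
  by rewrite -(addn1 d') -(addn1 i'.+1) !PoszD opprD addrACA subrr addr0.
rewrite (reg_quotient_eq rgF) (reg_quotient_eq rgG).
by rewrite (pdim_quotient_eq pdF) (pdim_quotient_eq pdG) addn1.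
Qed.
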